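(* Let $S:\mathcal{E}\to\mathcal{E}$ be a random subshift of finite type over an invertible ergodic measure preserving system $(\Omega,\theta,\mathbb{P})$, with $S$-invariant probability measure $\nu$ with marginal $\mathbb{P}$ on $\Omega$, sample measures $(\mu_\omega)_{\omega\in\Omega}$ and marginal $\mu=\int\mu_\omega\,d\mathbb{P}$ on $X$. Let $a\in[0,1)$ be a constant, let $\alpha,\rho$ be functions with $\alpha(g)=\mathcal{O}(a^g)$ and $\rho(g)=\mathcal{O}(a^g)$, and let $\mathcal{B}$ be a Banach space of functions on $\Omega$ with norm $\|\cdot\|_{\mathcal{B}}$. Consider the following conditions. (1a) For all $n,m,g$ and all $A\in\mathcal{F}_0^n(X)$, $B\in\mathcal{F}_0^m(X)$: $\left|\mu(A\cap\sigma^{-g-n}B)-\mu(A)\mu(B)\right|\le\alpha(g)$. (1b) For all $n,g$ and all $A\in\mathcal{F}_0^n(X)$: $\left|\mu(A\cap\sigma^{-g-n}A)-\mu(A)^2\right|\le\alpha(g)$. (2) For all $n,m,g$ and all $A\in\mathcal{F}_0^n(X)$, $B\in\mathcal{F}_0^m(X)$, for $\mathbb{P}$-almost every $\omega\in\Omega$: $\left|\mu_\omega(A\cap\sigma^{-g-n}B)-\mu_\omega(A)\,\mu_{\theta^{n+g}\omega}(B)\right|\le\alpha(g)$. (3a) (exponential 3-mixing) For all $\psi,\phi,\varphi\in\mathcal{B}$ and all integers $n,m\ge1$, $$\left|\int_\Omega\psi\cdot\phi\circ\theta^n\cdot\varphi\circ\theta^{n+m}\,d\mathbb{P}-\int_\Omega\psi\,d\mathbb{P}\int_\Omega\phi\,d\mathbb{P}\int_\Omega\varphi\,d\mathbb{P}\right|\le\|\psi\|_{\mathcal{B}}\|\phi\|_{\mathcal{B}}\|\varphi\|_{\mathcal{B}}\,\rho(\min(n,m)).$$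 (3b) (exponential 4-mixing) For all $\psi,\phi,\varphi,\upsilon\in\mathcal{B}$ and all integers $n,m,l\ge1$, $$\left|\int_\Omega\psi\cdot\phi\circ\theta^n\cdot\varphi\circ\theta^{n+m}\cdot\upsilon\circ\theta^{n+m+l}\,d\mathbb{P}-\int_\Omega\psi\,d\mathbb{P}\int_\Omega\phi\,d\mathbb{P}\int_\Omega\varphi\,d\mathbb{P}\int_\Omega\upsilon\,d\mathbb{P}\right|\le\|\psi\|_{\mathcal{B}}\|\phi\|_{\mathcal{B}}\|\varphi\|_{\mathcal{B}}\|\upsilon\|_{\mathcal{B}}\,\rho(\min(n,m,l)).$$ (4) There exists $\xi\ge0$ such that for every $n\in\mathbb{N}$ and every cylinder $C\in\mathcal{F}_0^n(X)$, the functions $\psi_1:\omega\mapsto\mu_\omega(C)$ and $\psi_2:\omega\mapsto\max_{C_n}\mu_\omega(C_n)$ (maximum over all $n$-cylinders) belong to $\mathcal{B}$ and satisfy $\|\psi_1\|_{\mathcal{B}}\le\xi^n$ and $\|\psi_2\|_{\mathcal{B}}\le\xi^n$. Assume $0<\underline{H}_2(\mu)\le\overline{H}_2(\mu)<2h_0$ and that either (1a), (2), (3a) and (4) hold, or (1b), (2), (3b) and (4) hold. Then for $\mathbb{P}$-almost every $\omega\in\Omega$, $$\liminf_{n\to\infty}\frac{M_n(x,y)}{\log n}\ge\frac{2}{\overline{H}_2(\mu)}\quad\text{for }\mu_\omega\otimes\mu_\omega\text{-almost every }(x,y)\in\mathcal{E}_\omega\times\mathcal{E}_\omega.$$ Moreover,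 if the R\'enyi entropy exists (that is, $\underline{H}_2(\mu)=\overline{H}_2(\mu)=:H_2(\mu)$), then for $\mathbb{P}$-almost every $\omega\in\Omega$, $$\lim_{n\to\infty}\frac{M_n(x,y)}{\log n}=\frac{2}{H_2(\mu)}\quad\text{for }\mu_\omega\otimes\mu_\omega\text{-almost every }(x,y)\in\mathcal{E}_\omega\times\mathcal{E}_\omega.$$
   Context: Random subshift of finite type. $\mathbb{N}=\{0,1,2,\dots\}$. Let $(\Omega,\theta,\mathbb{P})$ be an invertible ergodic (probability) measure preserving system, $N\ge1$ an integer, $X=\{1,\dots,N\}^{\mathbb{N}}$ and $\sigma:X\to X$ the shift. Let $b:\Omega\to\{1,\dots,N\}$ be a random variable and let $A(\omega)=(a_{ij}(\omega))$, $\omega\in\Omega$, be a random transition matrix: $A(\omega)$ is a $b(\omega)\times b(\theta\omega)$ matrix with entries in $\{0,1\}$, with at least one non-zero entry in each row and each column, and $\omega\mapsto a_{ij}(\omega)$ is measurable for all $i,j$. Put $X_\omega=\{1,\dots,b(\omega)\}$, $$\mathcal{E}_\omega=\{x=(x_0,x_1,\dots):x_i\in X_{\theta^i\omega}\text{ and }a_{x_ix_{i+1}}(\theta^i\omega)=1\text{ for all }i\in\mathbb{N}\}\subset X,$$ $$\mathcal{E}=\{(\omega,x):\omega\in\Omega,\ x\in\mathcal{E}_\omega\}\subset\Omega\times X,\qquad S(\omega,x)=(\theta\omega,\sigma x).$$ Let $\nu$ be an $S$-invariant probability measure on $\mathcal{E}$ with marginal $\mathbb{P}$ on $\Omega$,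 and let $(\mu_\omega)_\omega$ be its decomposition, $d\nu(\omega,x)=d\mu_\omega(x)\,d\mathbb{P}(\omega)$; the $\mu_\omega$ are the sample measures, viewed as probability measures on $X$ giving full mass to $\mathcal{E}_\omega$. Let $\mu=\int\mu_\omega\,d\mathbb{P}$ be the marginal of $\nu$ on $X$. Cylinders. For $y\in X$, $C_n(y)=\{z\in X:z_i=y_i\text{ for }0\le i\le n-1\}$ is the $n$-cylinder containing $y$ (the only $0$-cylinder is $X$); $\mathcal{F}_0^n(X)$ is the sigma-algebra on $X$ generated by all $n$-cylinders. Banach space. $\mathcal{B}$ is a Banach space of real-valued measurable functions on $\Omega$ for which the integrals written in the mixing conditions make sense (for example H\''older continuous functions when $\Omega$ is a two-sided subshift). Longest common substring. For $x,y\in X$, $$M_n(x,y)=\max\{m:x_{i+k}=y_{j+k}\text{ for }k=1,\dots,m\text{ and for some }0\le i,j\le n-m\}.$$ Entropies. With sums and maxima taken over all $k$-cylinders $C_k$, $$\underline{H}_2(\mu)=\liminf_{k\to\infty}\frac{\log\sum\mu(C_k)^2}{-k},\quad\overline{H}_2(\mu)=\limsup_{k\to\infty}\frac{\log\sum\mu(C_k)^2}{-k},\quad h_0=\liminf_{k\to\infty}\frac{\log\int_\Omega\max_{C_k}\mu_\omega(C_k)\,d\mathbb{P}}{-k}.$$ *)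

(* Defs.v *)
(* MathComp-Analysis *)
From HB Require Import structures.
From mathcomp Require Export all_boot all_order all_algebra.
From mathcomp Require Export all_classical all_reals all_analysis.
Export Order.TTheory GRing.Theory Num.Theory.
Export numFieldNormedType.Exports.

Set Implicit Arguments.
Unset Strict Implicit.
Unset Printing Implicit Defensive.

Local Open Scope classical_set_scope.
Local Open Scope ring_scope.

HB.instance Definition _ (N : nat) := isPointed.Build 'I_N.+1 ord0.

Section sequence_space.
Variable N : nat.

(* The alphabet {1,...,N} with N >= 1 is encoded as 'I_N.+1, i.e. as
   {0,...,N}: letters are shifted by one, and N.+1 ranges over all integers
   >= 1. Words of length n index the n-cylinders bijectively. *)
Definition cylinder n (u : n.-tuple 'I_N.+1) : set (nat -> 'I_N.+1) :=
  [set x | forall i : 'I_n, x i = tnth u i].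

Definition cylinders n : set (set (nat -> 'I_N.+1)) := range (@cylinder n).

Definition seqspace :=
  g_sigma_algebraType (\bigcup_(n in [set: nat]) cylinders n).

HB.instance Definition _ := Measurable.copy seqspace
  (g_sigma_algebraType (\bigcup_(n in [set: nat]) cylinders n)).

Definition cyl_algebra n : set (set seqspace) := <<s cylinders n >>.

Definition shift (x : seqspace) : seqspace := fun i => x i.+1.

(* The indices i + k with k = 1, ..., m are written i + k.+1 with k < m. *)
Definition longest_match n (x y : seqspace) : nat :=
  \max_(m < n.+1 | [exists i : 'I_(n - m).+1, exists j : 'I_(n - m).+1,
                     forall k : 'I_m, x (i + k.+1)%N == y (j + k.+1)%N]) m.

End sequence_space.

Section random_sft.
Context {d : measure_display} {Omega : measurableType d} {R : realType}.
Variables (P : probability Omega R) (theta : Omega -> Omega) (N : nat).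
Implicit Types (b : Omega -> nat) (A : Omega -> 'M[bool]_N.+1).

Record invertible_ergodic_mps : Prop := {
  mps_measurable : measurable_fun setT theta;
  mps_invertible : exists theta' : Omega -> Omega,
    [/\ cancel theta theta', cancel theta' theta & measurable_fun setT theta'];
  mps_preserving : forall B : set Omega, measurable B ->
    P (theta @^-1` B) = P B;
  mps_ergodic : forall B : set Omega, measurable B ->
    theta @^-1` B = B -> P B = 0%E \/ P B = 1%E }.

(* X_w = {1,...,b w} is encoded as {i : 'I_N.+1 | i < b w}, and the
   b w x b (theta w) matrix A(w) as the upper-left block of a square matrix
   whose remaining entries are never used. *)
Record random_transition b A : Prop := {
  rt_range : forall w, (1 <= b w <= N.+1)%N;
  rt_measurable_size : measurable_fun setT b;
  rt_measurable_entry : forall i j : 'I_N.+1,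
    measurable [set w | [/\ (i < b w)%N, (j < b (theta w))%N & A w i j]];
  rt_row : forall w (i : 'I_N.+1), (i < b w)%N ->
    exists2 j : 'I_N.+1, (j < b (theta w))%N & A w i j;
  rt_col : forall w (j : 'I_N.+1), (j < b (theta w))%N ->
    exists2 i : 'I_N.+1, (i < b w)%N & A w i j }.

Definition fibre b A (w : Omega) : set (seqspace N) :=
  [set x : seqspace N | forall i, (x i < b (iter i theta w))%N /\
                     A (iter i theta w) (x i) (x i.+1)].

Definition bundle b A : set (Omega * seqspace N) :=
  [set p | fibre b A p.1 p.2].

Definition skew (p : Omega * seqspace N) : Omega * seqspace N :=
  (theta p.1, shift p.2).

Record invariant_on_bundle b A
    (nu : probability (Omega * seqspace N)%type R) : Prop := {
  inv_support : nu (bundle b A) = 1%E;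
  inv_skew : forall W, measurable W -> nu (skew @^-1` W) = nu W;
  inv_marginal : forall B, measurable B -> nu (B `*` setT) = P B }.

(* The decomposition of nu is only determined P-almost everywhere, so the
   sample measures are required to be carried by the fibres almost surely. *)
Record sample_measures b A (nu : probability (Omega * seqspace N)%type R)
    (mu : R.-pker Omega ~> seqspace N) : Prop := {
  sm_decomposition : forall W, measurable W ->
    nu W = (\int[P]_w mu w (xsection W w))%E;
  sm_support : {ae P, forall w, mu w (fibre b A w) = 1%E} }.

Section with_sample_measures.
Variable mu : R.-pker Omega ~> seqspace N.

Definition marginal (B : set (seqspace N)) : \bar R := (\int[P]_w mu w B)%E.

Definition max_cylinder k (w : Omega) : \bar R :=
  \big[maxe/-oo%E]_(u : k.-tuple 'I_N.+1) mu w (cylinder u).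

Definition log_sum_squares k : \bar R :=
  (lne (\sum_(u : k.-tuple 'I_N.+1) marginal (cylinder u) ^+ 2)
   / (- k%:R)%:E)%E.

Definition H2_lower : \bar R := limn_einf log_sum_squares.

Definition H2_upper : \bar R := limn_esup log_sum_squares.

Definition h_zero : \bar R :=
  limn_einf (fun k =>
    (lne (\int[P]_w max_cylinder k w) / (- k%:R)%:E)%E).

Definition marginal_mixing (alpha : nat -> R) : Prop :=
  forall (n m g : nat) (A B : set (seqspace N)),
    cyl_algebra n A -> cyl_algebra m B ->
    (`| marginal (A `&` iter (g + n) (@shift N) @^-1` B)
        - marginal A * marginal B | <= (alpha g)%:E)%E.

Definition marginal_self_mixing (alpha : nat -> R) : Prop :=
  forall (n g : nat) (A : set (seqspace N)),
    cyl_algebra n A ->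
    (`| marginal (A `&` iter (g + n) (@shift N) @^-1` A)
        - marginal A ^+ 2 | <= (alpha g)%:E)%E.

Definition fibre_mixing (alpha : nat -> R) : Prop :=
  forall (n m g : nat) (A B : set (seqspace N)),
    cyl_algebra n A -> cyl_algebra m B ->
    {ae P, forall w,
      (`| mu w (A `&` iter (g + n) (@shift N) @^-1` B)
          - mu w A * mu (iter (n + g) theta w) B | <= (alpha g)%:E)%E}.

End with_sample_measures.

Section with_function_space.
(* A Banach space of functions on Omega is a Banach space V together with a
   linear injection of V into the functions on Omega; iota f is f itself. *)
Variables (V : completeNormedModType R) (iota : {linear V -> (Omega -> R^o)}).

Record banach_function_space : Prop := {
  bfs_injective : injective iota;
  bfs_measurable : forall f : V, measurable_fun setT (iota f : Omega -> R) }.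

Definition has_integral (f : Omega -> R) : Prop :=
  P.-integrable setT (EFin \o f).

(* The mixing conditions include the requirement that the integrals they
   mention make sense. *)
Definition mixing3 (rho : nat -> R) : Prop :=
  forall (psi phi chi : V) (n m : nat), (1 <= n)%N -> (1 <= m)%N ->
    let F w := iota psi w * iota phi (iter n theta w)
               * iota chi (iter (n + m) theta w) in
    [/\ has_integral (iota psi), has_integral (iota phi),
        has_integral (iota chi), has_integral F
      & `| \int[P]_w F w
           - (\int[P]_w iota psi w) * (\int[P]_w iota phi w)
             * (\int[P]_w iota chi w) |
        <= `|psi| * `|phi| * `|chi| * rho (minn n m)].

Definition mixing4 (rho : nat -> R) : Prop :=
  forall (psi phi chi ups : V) (n m l : nat),
    (1 <= n)%N -> (1 <= m)%N -> (1 <= l)%N ->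
    let F w := iota psi w * iota phi (iter n theta w)
               * iota chi (iter (n + m) theta w)
               * iota ups (iter (n + m + l) theta w) in
    [/\ has_integral (iota psi) /\ has_integral (iota phi),
        has_integral (iota chi), has_integral (iota ups), has_integral F
      & `| \int[P]_w F w
           - (\int[P]_w iota psi w) * (\int[P]_w iota phi w)
             * (\int[P]_w iota chi w) * (\int[P]_w iota ups w) |
        <= `|psi| * `|phi| * `|chi| * `|ups| * rho (minn n (minn m l))].

Definition in_space_bounded (f : Omega -> R) (c : R) : Prop :=
  exists2 v : V, f = iota v & `|v| <= c.

Definition cylinder_regularity (mu : R.-pker Omega ~> seqspace N) : Prop :=
  exists2 xi : R, 0 <= xi &
    forall (n : nat),
      (forall u : n.-tuple 'I_N.+1,
        in_space_bounded (fun w => fine (mu w (cylinder u))) (xi ^+ n)) /\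
      in_space_bounded (fun w => fine (max_cylinder mu n w)) (xi ^+ n).

End with_function_space.

End random_sft.

(* Main.v *)
(* For a length k, let S count the pairs (i, j) of positions at which the words
   of length k read in x and in y agree. Averaged over (x, y) and then over
   omega, a pair of distant positions contributes the collision probability
   p = sum_C mu(C)^2, which is about exp(- k H_2). If n is smaller than
   exp(c k) with c < H_2 / 2, the mean of S decays exponentially in k: distant
   pairs contribute n^2 p, and each of the O(n k) remaining pairs at most
   the integral of max_C mu_omega(C), about exp(- k h_0), where h_0 > H_2 / 2.
   If n is larger than exp(c k) with c > H_2 / 2, the second moment method shows
   that S = 0 with exponentially small probability. Borel-Cantelli along k then
   gives both bounds for almost every omega.

   The second moment needs the joint law of four words. The sample measures
   factorise along one orbit by (2), so it remains to integrate a product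
   of four functions mu_(theta^t omega)(C): this is 4-mixing (3b), or,
   under (1a), the product is by (2) the sample measure of one
   intersection of cylinders, whose integral factorises. *)
From HB Require Import structures.
Require Import Defs.
From mathcomp Require Import measurable_realfun lra ring zify.

Set Implicit Arguments.
Unset Strict Implicit.
Unset Printing Implicit Defensive.

Local Open Scope classical_set_scope.
Local Open Scope ring_scope.

(** * Bounded random variables, second moments and Borel-Cantelli *)

(** Mixing errors get summed over pairs of words, hence multiplied by $(N+1)^{2k}$, and the norms in
    (4) may grow like $\xi^k$, so an error of fixed exponential rate in k is not enough. The remedy
    is a gap $L = Kk$ proportional to the word length: K is chosen after the target rate r, and the
    error becomes $D r^k$ for any prescribed $r > 0$. Since n is exponential in k, leaving such gaps
    costs only a factor linear in k, absorbed by an arbitrarily small change of the exponent c.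

    The second moment is centred at one deterministic number, the expected count $T^2 p$, and not at
    the mean on each fibre. The bound on a fibre can then be integrated over omega, and the
    fluctuation of the fibre means is controlled by the same fourfold estimate.

    As $M_n$ is nondecreasing in n, it is enough to know it at $n \approx \exp(ck)$. The exceptional
    null sets depend on c, so only countably many exponents, tending to $H_2/2$, are used. *)

Section bounded_measurable.
Context {d : measure_display} {T : measurableType d} {R : realType}.
Variable P : probability T R.
Implicit Types f g : T -> R.

(** The integrands below are built from probabilities by sums and products. Boundedness passes to
    products, which integrability does not, and implies integrability for a probability. *)
Definition bounded_measurable f : Prop :=
  measurable_fun setT f /\ exists M, forall w, `|f w| <= M.

Lemma bounded_measurable_cst (c : R) : bounded_measurable (fun=> c).
Proof. by split; [exact: measurable_cst | exists `|c|]. Qed.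

Lemma bounded_measurableD f g : bounded_measurable f -> bounded_measurable g ->
  bounded_measurable (fun w => f w + g w).
Proof.
move=> [mf [M fM]] [mg [M' gM']]; split; first exact: measurable_funD.
exists (M + M') => w; rewrite (le_trans (ler_normD _ _))// lerD//.
Qed.

Lemma bounded_measurableM f g : bounded_measurable f -> bounded_measurable g ->
  bounded_measurable (fun w => f w * g w).
Proof.
move=> [mf [M fM]] [mg [M' gM']]; split; first exact: measurable_funM.
by exists (M * M') => w; rewrite normrM ler_pM.
Qed.

Lemma bounded_measurable_sum (I : Type) (r : seq I) (p : pred I)
    (F : I -> T -> R) : (forall i, bounded_measurable (F i)) ->
  bounded_measurable (fun w => \sum_(i <- r | p i) F i w).
Proof.
move=> bF; elim: r => [|i r IH].
  under eq_fun do rewrite big_nil; exact: bounded_measurable_cst.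
under eq_fun do rewrite big_cons.
by case: (p i) => //; exact: bounded_measurableD.
Qed.

Lemma bounded_measurable_comp f (phi : T -> T) : measurable_fun setT phi ->
  bounded_measurable f -> bounded_measurable (f \o phi).
Proof.
move=> mphi [mf [M fM]]; split; first exact: measurableT_comp.
by exists M => w /=.
Qed.

Lemma bounded_measurable_integrable f :
  bounded_measurable f -> P.-integrable setT (EFin \o f).
Proof.
move=> [mf [M fM]]; apply: measurable_bounded_integrable => //.
  by rewrite ltey_eq fin_num_measure.
exists M; split; first exact: num_real.
by move=> x Mx w _ /=; rewrite (le_trans (fM w))// ltW.
Qed.

Lemma expectation_cst (c : R) : \int[P]_w c = c.
Proof.
rewrite Rintegral_cst//; have /(congr1 fine)/= -> := probability_setT P.
by rewrite mulr1.
Qed.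

Lemma expectationD f g : bounded_measurable f -> bounded_measurable g ->
  \int[P]_w (f w + g w) = \int[P]_w f w + \int[P]_w g w.
Proof. by move=> bf bg; apply: RintegralD => //; exact: bounded_measurable_integrable. Qed.

Lemma expectationZ (c : R) f : bounded_measurable f ->
  \int[P]_w (c * f w) = c * \int[P]_w f w.
Proof. by move=> bf; apply: RintegralZl => //; exact: bounded_measurable_integrable. Qed.

Lemma expectation_sum (I : Type) (r : seq I) (p : pred I) (F : I -> T -> R) :
  (forall i, bounded_measurable (F i)) ->
  \int[P]_w (\sum_(i <- r | p i) F i w) = \sum_(i <- r | p i) \int[P]_w F i w.
Proof.
move=> bF; elim: r => [|i r IH].
  rewrite big_nil; under eq_Rintegral do rewrite big_nil.
  exact: expectation_cst.
rewrite big_cons; under eq_Rintegral do rewrite big_cons.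
case: (p i) => //; rewrite expectationD ?IH//.
exact: bounded_measurable_sum.
Qed.

Lemma expectation_le f g : bounded_measurable f -> bounded_measurable g ->
  (forall w, f w <= g w) -> \int[P]_w f w <= \int[P]_w g w.
Proof.
by move=> bf bg fg; apply: le_Rintegral => //; exact: bounded_measurable_integrable.
Qed.

Lemma expectation_ae_eq f g : bounded_measurable f -> bounded_measurable g ->
  {ae P, forall w, f w = g w} -> \int[P]_w f w = \int[P]_w g w.
Proof.
move=> [mf _] [mg _] fg; congr fine; apply: ae_eq_integral => //.
- exact/measurable_EFinP.
- exact/measurable_EFinP.
- by apply: filterS fg => w /= -> _.
Qed.

Lemma bounded_measurable_norm f :
  bounded_measurable f -> bounded_measurable (fun w => `|f w|).
Proof.
move=> [mf [M fM]]; split; first exact: measurableT_comp.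
by exists M => w; rewrite normr_id.
Qed.

(** The mixing estimates between sample measures hold for almost every omega only; this is how they
    enter integrals. *)
Lemma expectation_dist f g (e : R) : 0 <= e -> bounded_measurable f -> bounded_measurable g ->
  {ae P, forall w, `|f w - g w| <= e} ->
  `|\int[P]_w f w - \int[P]_w g w| <= e.
Proof.
move=> e0 bf bg fge.
have bNg : bounded_measurable (fun w => -1 * g w).
  by apply: bounded_measurableM => //; exact: bounded_measurable_cst.
have bh := bounded_measurableD bf bNg.
have -> : \int[P]_w f w - \int[P]_w g w = \int[P]_w (f w + -1 * g w).
  by rewrite expectationD// expectationZ// mulN1r.
apply: (le_trans (le_normr_Rintegral _ _)) => //.
  exact: bounded_measurable_integrable.
rewrite -[leRHS](expectation_cst e) /Rintegral.
have bn := bounded_measurable_norm bh.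
have be := bounded_measurable_cst e.
rewrite fine_le//.
- by apply: integrable_fin_num => //; exact: bounded_measurable_integrable bn.
- by apply: integrable_fin_num => //; exact: bounded_measurable_integrable be.
apply: ae_ge0_le_integral => //.
- by apply/measurable_EFinP; case: bn.
- by apply: filterS fge => w /= + _; rewrite mulN1r lee_fin.
Qed.

Lemma expectation_comp f (phi : T -> T) : measurable_fun setT phi ->
  (forall B, measurable B -> P (phi @^-1` B) = P B) -> bounded_measurable f ->
  \int[P]_w f (phi w) = \int[P]_w f w.
Proof.
move=> mphi inv bf; congr fine.
have bfp := bounded_measurable_comp mphi bf.
have [mf _] := bf.
rewrite -[LHS](@integral_pushforward _ _ _ _ _ phi mphi P setT (EFin \o f))//; last 2 first.
- exact/measurable_EFinP.
- exact: bounded_measurable_integrable.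
by apply: eq_measure_integral => B mB _; rewrite -[RHS]inv.
Qed.

Lemma ae_comp (phi : T -> T) (A : T -> Prop) : measurable_fun setT phi ->
  (forall B, measurable B -> P (phi @^-1` B) = P B) ->
  {ae P, forall w, A w} -> {ae P, forall w, A (phi w)}.
Proof.
move=> mphi inv [B [mB PB AB]]; exists (phi @^-1` B); split.
- by rewrite -[X in measurable X]setTI; exact: mphi.
- by rewrite inv.
- by move=> w /= nA; exact: AB.
Qed.

End bounded_measurable.

Section second_moment.
Context {d : measure_display} {T : measurableType d} {R : realType}.
Variable Q : probability T R.

Lemma bounded_measurable_indic (A : set T) : measurable A ->
  bounded_measurable (\1_A : T -> R).
Proof.
move=> mA; split; first exact: measurable_indic.
by exists 1 => w; rewrite indicE; case: (_ \in _); rewrite ?normr1 ?normr0.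
Qed.

Lemma expectation_indic (A : set T) : measurable A ->
  \int[Q]_w (\1_A w) = fine (Q A).
Proof. by move=> mA; rewrite /Rintegral integral_indic// setIT. Qed.

(** Chebyshev's inequality in pointwise form: if S counts the events that occur, then $M^2 1_{S=0}
    \le (S-M)^2$. Since M need not be the mean of S, the same M can serve for all the measures of a
    random family. *)
Lemma second_moment (I : finType) (E : I -> set T) (M : R) :
  (forall i, measurable (E i)) ->
  M ^+ 2 * fine (Q [set x | forall i, ~ E i x]) <=
  \sum_i \sum_j fine (Q (E i `&` E j)) - 2 * M * \sum_i fine (Q (E i)) + M ^+ 2.
Proof.
move=> mE.
set Z := [set x | _].
have mZ : measurable Z.
  have -> : Z = \bigcap_(i in [set: I]) ~` E i.
    by apply/seteqP; split=> x /= xE i; [move=> _; exact: xE | exact: (xE i Logic.I)].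
  by apply: fin_bigcap_measurable => // i _; exact: measurableC.
have bE i := bounded_measurable_indic (mE i).
have bEE i j := bounded_measurable_indic (measurableI _ _ (mE i) (mE j)).
have bZ := bounded_measurable_indic mZ.
rewrite -expectation_indic// -expectationZ//.
have b1 : bounded_measurable (fun x => \sum_i \sum_j (\1_(E i `&` E j) x : R)).
  by do 2 apply: bounded_measurable_sum => ?.
have b2 : bounded_measurable (fun x => - (2 * M) * \sum_i (\1_(E i) x : R)).
  apply: bounded_measurableM; first exact: bounded_measurable_cst.
  exact: bounded_measurable_sum.
have b3 := bounded_measurable_cst (M ^+ 2).
have -> : \sum_i \sum_j fine (Q (E i `&` E j)) -
    2 * M * \sum_i fine (Q (E i)) + M ^+ 2 =
  \int[Q]_x (\sum_i \sum_j (\1_(E i `&` E j) x)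
    + - (2 * M) * \sum_i \1_(E i) x + M ^+ 2).
  rewrite expectationD//; last exact: bounded_measurableD.
  rewrite expectationD// expectation_cst expectationZ; last exact: bounded_measurable_sum.
  rewrite !expectation_sum//; last by move=> i; exact: bounded_measurable_sum.
  rewrite mulNr; congr (_ - _ * _ + _).
    apply: eq_bigr => i _; rewrite expectation_sum//; apply: eq_bigr => j _.
    by rewrite expectation_indic//; exact: measurableI.
  by apply: eq_bigr => i _; rewrite expectation_indic.
apply: expectation_le.
- by apply: bounded_measurableM => //; exact: bounded_measurable_cst.
- by apply: bounded_measurableD => //; exact: bounded_measurableD.
move=> x /=; set s := \sum_i \1_(E i) x.
have -> : \sum_i \sum_j (\1_(E i `&` E j) x : R) = s * s.
  rewrite /s big_distrl/=; apply: eq_bigr => i _.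
  by rewrite big_distrr/=; apply: eq_bigr => j _; rewrite indicI.
rewrite [\1_Z x]indicE; have [xZ|xZ] := boolP (x \in Z); last first.
  by rewrite mulr0; have := sqr_ge0 (s - M); nra.
have -> : s = 0 by rewrite /s big1// => i _; rewrite indicE memNset//; move: xZ; rewrite inE; apply.
by rewrite !mulr0 mulr1 !add0r.
Qed.

End second_moment.

Section borel_cantelli.
Context {d : measure_display} {Omega : measurableType d} {R : realType}.
Context {d' : measure_display} {X : measurableType d'}.
Variables (P : probability Omega R) (Q : Omega -> probability X R).

Lemma geometric_partial_sum_le (r : R) n : 0 < r < 1 ->
  \sum_(0 <= k < n) r ^+ k <= (1 - r)^-1.
Proof.
move=> /andP[r0 r1].
have {1}-> : \sum_(0 <= k < n) r ^+ k = (1 - r ^+ n) / (1 - r).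
  elim: n => [|n IH]; first by rewrite big_geq// expr0 subrr mul0r.
  rewrite big_nat_recr//= IH exprS; field; lra.
rewrite ler_piMl// ?invr_ge0; first lra.
by have := exprn_ge0 n (ltW r0); lra.
Qed.

(** By monotone convergence $\sum_k g_k$ is integrable, hence finite for almost every w; then
    $Q_w(B_k)$ is summable and Borel-Cantelli applies under $Q_w$. The majorants [g k] carry the
    measurability in w. *)
Lemma ae_eventually_notin (B : nat -> set X) (g : nat -> Omega -> R)
    (D r : R) (k0 : nat) :
  0 <= D -> 0 < r < 1 -> (forall k, measurable (B k)) ->
  (forall k, bounded_measurable (g k)) ->
  (forall k w, (k0 <= k)%N -> fine (Q w (B k)) <= g k w) ->
  (forall k, (k0 <= k)%N -> \int[P]_w g k w <= D * r ^+ k) ->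
  {ae P, forall w, {ae Q w, forall x,
    exists k1, forall k, (k1 <= k)%N -> ~ B k x}}.
Proof.
move=> D0 r01 mB bg Qg gD; have /andP[r0 r1] := r01.
(* The bounds, and with them the sign of [g], are known from index [k0] on only. *)
pose h k w : \bar R := (g (k + k0)%N w)%:E.
have h0 k w : (0 <= h k w)%E.
  by rewrite lee_fin (le_trans _ (Qg _ _ (leq_addl _ _)))// fine_ge0.
have mh k : measurable_fun setT (h k) by apply/measurable_EFinP; case: (bg (k + k0)%N).
have ih : (\int[P]_w (\sum_(k <oo) h k w) < +oo)%E.
  rewrite integral_nneseries//.
  apply: (@le_lt_trans _ _ (D * (1 - r)^-1)%:E); last exact: ltry.
  apply: lime_le; first by apply: is_cvg_nneseries => k _ _; exact: integral_ge0.
  apply: nearW => n.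
  apply: (@le_trans _ _ (\sum_(0 <= k < n) (D * r ^+ k)%:E)%E).
    apply: lee_sum => k _.
    have -> : (\int[P]_w h k w = (\int[P]_w g (k + k0)%N w)%:E)%E.
      rewrite fineK//; apply: integrable_fin_num => //.
      exact: bounded_measurable_integrable.
    rewrite lee_fin (le_trans (gD _ (leq_addl _ _)))// ler_wpM2l//.
    by rewrite ler_wiXn2l ?leq_addr// ltW.
  rewrite sumEFin lee_fin -mulr_sumr ler_wpM2l//.
  exact: geometric_partial_sum_le.
have : {ae P, forall w, setT w -> (\sum_(k <oo) h k w)%E \is a fin_num}.
  apply: integrable_ae => //; apply/integrableP; split.
    by apply: ge0_emeasurable_sum => // *; exact: h0.
  apply: le_lt_trans ih; apply: ge0_le_integral => //.
  - by apply: measurableT_comp => //; apply: ge0_emeasurable_sum => // *; exact: h0.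
  - by apply: ge0_emeasurable_sum => // *; exact: h0.
  - by move=> w _; rewrite gee0_abs//; exact: nneseries_ge0.
apply: filterS => w /= /(_ I) hw.
have QB : (\sum_(k <oo) Q w (B (k + k0)%N) < +oo)%E.
  apply: (@le_lt_trans _ _ (\sum_(k <oo) h k w)%E).
    apply: lee_nneseries => // k _.
    rewrite -[leLHS]fineK; first by rewrite lee_fin Qg// leq_addl.
    by rewrite fin_num_measure.
  by rewrite ltey_eq hw.
have L0 := lim_sup_set_cvg0 (fun k => mB (k + k0)%N) QB.
exists (lim_sup_set (fun k => B (k + k0)%N)); split => //.
  by apply: bigcapT_measurable => n; apply: bigcup_measurable => k _; exact: mB.
move=> x /= nB n _; apply: contrapT => nx; apply: nB; exists (n + k0)%N => k nk Bx.
apply: nx; exists (k - k0)%N; first by rewrite /= leq_subRL ?(leq_trans (leq_addl _ _) nk)// addnC.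
by rewrite subnK// (leq_trans (leq_addl _ _) nk).
Qed.

End borel_cantelli.

(** * Mixing for products of cylinder functions *)

Notation "t .-shift C" := (iter t (@shift _) @^-1` C)
  (at level 2, C at level 1, format "t .-shift  C") : classical_set_scope.

Section coordinates.
Variable N : nat.
Implicit Types (A B : set (seqspace N)) (x y : seqspace N).

(** Measurability with respect to the first n coordinates, stated as an invariance: intersections
    and shifts are then immediate, and [depends_cyl_algebra] leads back to the sigma-algebras of the
    mixing conditions. *)
Definition depends n A : Prop :=
  forall x y, (forall i, (i < n)%N -> x i = y i) -> A x -> A y.

Lemma iter_shift t x i : iter t (@shift N) x i = x (i + t)%N.
Proof. by elim: t i => [|t IH] i; rewrite ?addn0//= /shift IH addSnnS. Qed.

Lemma dependsT n : depends n setT.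
Proof. by []. Qed.

Lemma dependsI n A B : depends n A -> depends n B -> depends n (A `&` B).
Proof. by move=> dA dB x y xy [Ax Bx]; split; [exact: dA xy Ax | exact: dB xy Bx]. Qed.

Lemma depends_le m n A : (m <= n)%N -> depends m A -> depends n A.
Proof. by move=> mn dA x y xy; apply: dA => i im; apply: xy; exact: leq_trans mn. Qed.

Lemma depends_shift t n A :
  depends n A -> depends (t + n) (t .-shift A).
Proof.
move=> dA x y xy /=; apply: dA => i iln.
by rewrite !iter_shift xy// addnC ltn_add2l.
Qed.

Lemma depends_cylinder n (u : n.-tuple 'I_N.+1) : depends n (cylinder u).
Proof. by move=> x y xy /= xu i; rewrite -xy. Qed.

Lemma depends_cyl_algebra n A : depends n A -> cyl_algebra n A.
Proof.
move=> dA.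
(* The alphabet is finite, so this is a finite union of generators. *)
have -> : A = \bigcup_(u in [set u : n.-tuple 'I_N.+1 | cylinder u `<=` A]) cylinder u.
  apply/seteqP; split=> [x Ax|x [u /= uA]]; last exact: uA.
  exists [tuple x i | i < n]; last by move=> i; rewrite tnth_mktuple.
  move=> y /= yx; apply: dA Ax => i iln.
  by have := yx (Ordinal iln); rewrite tnth_mktuple.
apply: (@fin_bigcup_measurable _ (g_sigma_algebraType (@cylinders N n))) => //.
by move=> u _; apply: sub_sigma_algebra; exists u.
Qed.

Lemma depends_measurable n A : depends n A -> measurable A.
Proof.
move=> /depends_cyl_algebra; apply: sub_sigma_algebra2 => B nB.
by exists n.
Qed.

(* With the full space allowed, the fourfold estimates below contain the two-
   and threefold ones. *)
Definition cylinder_or_full k A : Prop :=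
  (exists u : k.-tuple 'I_N.+1, A = cylinder u) \/ A = setT.

Lemma cylinder_or_full_depends k A : cylinder_or_full k A -> depends k A.
Proof. by move=> [[u ->]|->]; [exact: depends_cylinder | exact: dependsT]. Qed.

End coordinates.

Section mixing.
Context {d : measure_display} {Omega : measurableType d} {R : realType}.
Variables (P : probability Omega R) (theta : Omega -> Omega) (N : nat).
Variable mu : R.-pker Omega ~> seqspace N.
Hypothesis Hmps : invertible_ergodic_mps P theta.
Implicit Types A C : set (seqspace N).

Definition sample_prob A (w : Omega) : R := fine (mu w A).

Definition marginal_prob A : R := \int[P]_w sample_prob A w.

Lemma mu_le1 A w : measurable A -> (mu w A <= 1)%E.
Proof.
move=> mA; rewrite -(@prob_kernel _ _ _ _ _ mu w).
by apply: le_measure; rewrite ?inE.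
Qed.

Lemma mu_fin A w : measurable A -> mu w A \is a fin_num.
Proof. by move=> mA; rewrite ge0_fin_numE// (le_lt_trans (mu_le1 w mA))// ltry. Qed.

Lemma sample_probE A w : measurable A -> (sample_prob A w)%:E = mu w A.
Proof. by move=> mA; rewrite fineK// mu_fin. Qed.

Lemma sample_prob_ge0 A w : 0 <= sample_prob A w.
Proof. exact: fine_ge0. Qed.

Lemma sample_prob_le1 A w : measurable A -> sample_prob A w <= 1.
Proof. by move=> mA; rewrite -lee_fin sample_probE// mu_le1. Qed.

Lemma sample_probT w : sample_prob setT w = 1.
Proof. by rewrite /sample_prob prob_kernel. Qed.

Lemma bounded_measurable_sample_prob A :
  measurable A -> bounded_measurable (sample_prob A).
Proof.
move=> mA; split; last first.
  by exists 1 => w; rewrite ger0_norm ?sample_prob_ge0// sample_prob_le1.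
by apply: measurableT_comp => //; exact: measurable_kernel.
Qed.

Lemma marginalE A : measurable A -> marginal P mu A = (marginal_prob A)%:E.
Proof.
move=> mA; rewrite /marginal_prob /Rintegral fineK.
  by apply: eq_integral => w _; rewrite sample_probE.
apply: integrable_fin_num => //; apply: bounded_measurable_integrable.
exact: bounded_measurable_sample_prob.
Qed.

Lemma marginal_prob_ge0 A : 0 <= marginal_prob A.
Proof. by apply: Rintegral_ge0 => w _; exact: sample_prob_ge0. Qed.

Lemma marginal_prob_le1 A : measurable A -> marginal_prob A <= 1.
Proof.
move=> mA; rewrite -[leRHS](expectation_cst P); apply: expectation_le.
- exact: bounded_measurable_sample_prob.
- exact: bounded_measurable_cst.
- by move=> w; exact: sample_prob_le1.
Qed.

Lemma marginal_probT : marginal_prob setT = 1.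
Proof.
rewrite -[RHS](expectation_cst P); apply: eq_Rintegral => w _.
exact: sample_probT.
Qed.

Lemma measurable_iter t : measurable_fun setT (iter t theta).
Proof.
elim: t => [|t IH]; first exact: measurable_id.
by apply: (measurableT_comp (mps_measurable Hmps) IH).
Qed.

Lemma preserving_iter t (B : set Omega) :
  measurable B -> P (iter t theta @^-1` B) = P B.
Proof.
elim: t B => [//|t IH] B mB.
rewrite -[RHS](mps_preserving Hmps)// -[RHS]IH//.
by rewrite -[_ @^-1` _]setTI; exact: (mps_measurable Hmps).
Qed.

Lemma bounded_measurable_iter t (f : Omega -> R) :
  bounded_measurable f -> bounded_measurable (fun w => f (iter t theta w)).
Proof. by move=> bf; apply: (bounded_measurable_comp (measurable_iter t) bf). Qed.

Lemma expectation_iter t (f : Omega -> R) : bounded_measurable f ->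
  \int[P]_w f (iter t theta w) = \int[P]_w f w.
Proof.
by apply: expectation_comp; [exact: measurable_iter | exact: preserving_iter].
Qed.

(** Condition (2) in terms of the absolute time t at which B is read: the gap is t - n, and from L
    on the error is uniformly at most e. *)
Lemma fibre_mixing_sample_prob (alpha : nat -> R) L e n m t A (B : set (seqspace N)) :
  fibre_mixing P theta mu alpha -> (forall g, (L <= g)%N -> `|alpha g| <= e) ->
  depends n A -> depends m B -> (n + L <= t)%N ->
  {ae P, forall w, `|sample_prob (A `&` t .-shift B) w
                     - sample_prob A w * sample_prob B (iter t theta w)| <= e}.
Proof.
move=> fm ae dA dB nLt.
have mA := depends_measurable dA; have mB := depends_measurable dB.
have mAB : measurable (A `&` t .-shift B).
  by apply: measurableI => //; exact: (depends_measurable (depends_shift dB)).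
have /= := fm n m (t - n)%N A B (depends_cyl_algebra dA) (depends_cyl_algebra dB).
rewrite subnK ?subnKC; [|lia|lia].
apply: filterS => w; rewrite -!sample_probE// -EFinM -EFinB abse_EFin lee_fin => /le_trans.
by apply; rewrite (le_trans (ler_norm _))// ae//; lia.
Qed.

(** The common outcome of the two alternative sets of hypotheses. The requirement [L <= t1] treats
    the origin as the end of an empty word, which puts the first factor on the same footing as the
    others. *)
Definition mixing_at_level (k L : nat) (e : R) : Prop :=
  forall C1 C2 C3 C4, cylinder_or_full k C1 -> cylinder_or_full k C2 ->
    cylinder_or_full k C3 -> cylinder_or_full k C4 ->
  forall t1 t2 t3 t4, (L <= t1)%N -> (t1 + k + L <= t2)%N ->
    (t2 + k + L <= t3)%N -> (t3 + k + L <= t4)%N ->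
  `|\int[P]_w (sample_prob C1 (iter t1 theta w) * sample_prob C2 (iter t2 theta w)
       * sample_prob C3 (iter t3 theta w) * sample_prob C4 (iter t4 theta w))
    - marginal_prob C1 * marginal_prob C2 * marginal_prob C3 * marginal_prob C4|
  <= e.

(** One link of a product estimate: splitting off a further factor f in [0,1] adds its own error e
    and does not enlarge the error a made before. *)
Lemma dist_mul_chain (x y z f a e : R) : 0 <= f <= 1 ->
  `|x - y| <= a -> `|z - x * f| <= e -> `|z - y * f| <= a + e.
Proof.
move=> /andP[f0 f1] xy zx.
have -> : z - y * f = (x - y) * f + (z - x * f) by ring.
rewrite (le_trans (ler_normD _ _))// lerD//.
by rewrite normrM (ger0_norm f0) (le_trans _ xy)// ler_piMr.
Qed.

(* Both the sample measures and mu factorise one cylinder at a time along the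
   partial intersections W1, ..., W4, and the integral of mu_omega(W4) is
   mu(W4). *)
Lemma mixing_at_level_marginal (alpha : nat -> R) k L e : 0 <= e ->
  (forall g, (L <= g)%N -> `|alpha g| <= e) ->
  marginal_mixing P mu alpha -> fibre_mixing P theta mu alpha ->
  mixing_at_level k L (8 * e).
Proof.
move=> e0 ae mm fm C1 C2 C3 C4 c1 c2 c3 c4 t1 t2 t3 t4 l1 l2 l3 l4.
have d1 := cylinder_or_full_depends c1; have d2 := cylinder_or_full_depends c2.
have d3 := cylinder_or_full_depends c3; have d4 := cylinder_or_full_depends c4.
pose W1 := setT `&` t1 .-shift C1; pose W2 := W1 `&` t2 .-shift C2.
pose W3 := W2 `&` t3 .-shift C3; pose W4 := W3 `&` t4 .-shift C4.
have dS (t : nat) C m : depends k C -> (t + k <= m)%N -> depends m (t .-shift C).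
  by move=> dC tm; exact: (depends_le tm (depends_shift dC)).
have dW0 : depends 0 (setT : set (seqspace N)) by exact: dependsT.
have dW1 : depends (t1 + k) W1 by apply: dependsI; [exact: dependsT|exact: dS].
have dW2 : depends (t2 + k) W2.
  by apply: dependsI; [apply: depends_le dW1; lia|exact: dS].
have dW3 : depends (t3 + k) W3.
  by apply: dependsI; [apply: depends_le dW2; lia|exact: dS].
have dW4 : depends (t4 + k) W4.
  by apply: dependsI; [apply: depends_le dW3; lia|exact: dS].
have mC1 := depends_measurable d1; have mC2 := depends_measurable d2.
have mC3 := depends_measurable d3; have mC4 := depends_measurable d4.
have mW1 := depends_measurable dW1; have mW2 := depends_measurable dW2.
have mW3 := depends_measurable dW3; have mW4 := depends_measurable dW4.
have MW n t A C : depends n A -> depends k C -> (n + L <= t)%N ->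
    `|marginal_prob (A `&` t .-shift C) - marginal_prob A * marginal_prob C| <= e.
  move=> dA dC nLt; have mA := depends_measurable dA.
  have mC := depends_measurable dC.
  have mAC : measurable (A `&` t .-shift C).
    by apply: measurableI => //; exact: (depends_measurable (depends_shift dC)).
  have /= := mm n k (t - n)%N A C (depends_cyl_algebra dA) (depends_cyl_algebra dC).
  rewrite subnK; last lia.
  rewrite !marginalE// -EFinM -EFinB abse_EFin lee_fin => /le_trans; apply.
  by rewrite (le_trans (ler_norm _))// ae//; lia.
have M01 C : depends k C -> 0 <= marginal_prob C <= 1.
  by move=> /depends_measurable mC; rewrite marginal_prob_ge0 marginal_prob_le1.
have s01 t w C : depends k C -> 0 <= sample_prob C (iter t theta w) <= 1.
  by move=> /depends_measurable mC; rewrite sample_prob_ge0 sample_prob_le1.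
have MW4 : `|marginal_prob W4 - marginal_prob C1 * marginal_prob C2
      * marginal_prob C3 * marginal_prob C4| <= e + e + e + e.
  apply: (dist_mul_chain (M01 _ d4)); last by apply: MW dW3 d4 _.
  apply: (dist_mul_chain (M01 _ d3)); last by apply: MW dW2 d3 _.
  apply: (dist_mul_chain (M01 _ d2)); last by apply: MW dW1 d2 _.
  by have := MW _ t1 _ _ dW0 d1 l1; rewrite marginal_probT mul1r.
have bm t C : depends k C ->
    bounded_measurable (fun w => sample_prob C (iter t theta w)).
  move=> /depends_measurable mC; apply: bounded_measurable_iter.
  exact: bounded_measurable_sample_prob.
(* Four errors for the factorisation of the sample measures, four for that of mu. *)
have -> : (8 * e = (e + e + e + e) + (e + e + e + e)) by ring.
set I := Rintegral _ _ _; set J := marginal_prob C1 * _ * _ * _.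
have -> : I - J = (I - marginal_prob W4) + (marginal_prob W4 - J) by ring.
rewrite (le_trans (ler_normD _ _))// lerD// distrC.
apply: expectation_dist; first by rewrite !addr_ge0.
- exact: bounded_measurable_sample_prob.
- by do !apply: bounded_measurableM; exact: bm.
have F0 := fibre_mixing_sample_prob fm ae dW0 d1 l1.
have F1 := fibre_mixing_sample_prob fm ae dW1 d2 l2.
have F2 := fibre_mixing_sample_prob fm ae dW2 d3 l3.
have F3 := fibre_mixing_sample_prob fm ae dW3 d4 l4.
apply: filterS2 (filterI F0 F1) (filterI F2 F3) => w [f0 f1] [f2 f3].
apply: (dist_mul_chain (s01 _ _ _ d4)); last exact: f3.
apply: (dist_mul_chain (s01 _ _ _ d3)); last exact: f2.
apply: (dist_mul_chain (s01 _ _ _ d2)); last exact: f1.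
by move: f0; rewrite sample_probT mul1r.
Qed.

Section function_space.
Variables (V : completeNormedModType R) (iota : {linear V -> (Omega -> R^o)}).

(** Replacing xi by max(1, xi) lets one bound $\xi^k$ cover the full space as well, which is the
    cylinder of the empty word and so has norm at most $\xi^0 = 1$. *)
Lemma cylinder_regularity_norm : cylinder_regularity iota mu ->
  exists2 xi : R, 1 <= xi & forall k C, cylinder_or_full k C ->
    in_space_bounded iota (sample_prob C) (xi ^+ k).
Proof.
move=> [xi xi0 reg]; exists (Num.max 1 xi); first by rewrite le_max lexx.
move=> k C [[u ->]|->].
  have [v vE vle] := (reg k).1 u; exists v => //.
  by rewrite (le_trans vle)// lerXn2r ?nnegrE// le_max ?ler01 ?lexx ?orbT.
have [v vE vle] := (reg 0%N).1 [tuple].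
exists v; last by rewrite (le_trans vle)// expr0 exprn_ege1// le_max lexx.
rewrite -vE; apply/funext => w; congr (fine (mu w _)).
by apply/seteqP; split=> // x _ [].
Qed.

(** By invariance of P only the increments of the times matter, and these are at least L, hence
    positive as 4-mixing demands. The four norms multiply to $\xi^{4k}$. *)
Lemma mixing_at_level_mixing4 (rho : nat -> R) (xi : R) k L e : 0 <= e ->
  (0 < L)%N -> (forall g, (L <= g)%N -> `|rho g| <= e) ->
  mixing4 P theta iota rho -> 1 <= xi ->
  (forall C, cylinder_or_full k C ->
    in_space_bounded iota (sample_prob C) (xi ^+ k)) ->
  mixing_at_level k L (xi ^+ (4 * k) * e).
Proof.
move=> e0 L0 re m4 xi1 reg C1 C2 C3 C4 c1 c2 c3 c4 t1 t2 t3 t4 l1 l2 l3 l4.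
have [v1 E1 n1] := reg _ c1; have [v2 E2 n2] := reg _ c2.
have [v3 E3 n3] := reg _ c3; have [v4 E4 n4] := reg _ c4.
have [] := m4 v1 v2 v3 v4 (t2 - t1)%N (t3 - t2)%N (t4 - t3)%N; try lia.
move=> _ _ _ _; rewrite -E1 -E2 -E3 -E4 => H.
have bm C : cylinder_or_full k C -> bounded_measurable (sample_prob C).
  move=> /cylinder_or_full_depends/depends_measurable.
  exact: bounded_measurable_sample_prob.
pose F w := sample_prob C1 w * sample_prob C2 (iter (t2 - t1) theta w)
  * sample_prob C3 (iter (t2 - t1 + (t3 - t2)) theta w)
  * sample_prob C4 (iter (t2 - t1 + (t3 - t2) + (t4 - t3)) theta w).
have bF : bounded_measurable F.
  do !apply: bounded_measurableM; try exact: bm;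
    by apply: bounded_measurable_iter; exact: bm.
have <- : \int[P]_w F (iter t1 theta w) =
    \int[P]_w (sample_prob C1 (iter t1 theta w) * sample_prob C2 (iter t2 theta w)
    * sample_prob C3 (iter t3 theta w) * sample_prob C4 (iter t4 theta w)).
  apply: eq_Rintegral => w _; rewrite /F -!iterD.
  by congr (_ * sample_prob _ (iter _ _ _) * sample_prob _ (iter _ _ _)
           * sample_prob _ (iter _ _ _)); lia.
rewrite expectation_iter//; apply: le_trans H _.
set g := minn _ _.
have ge : rho g <= e by rewrite (le_trans (ler_norm _))// re// /g; lia.
have x0 : 0 <= xi ^+ k by rewrite exprn_ge0// (le_trans _ xi1).
apply: (@le_trans _ _ (`|v1| * `|v2| * `|v3| * `|v4| * e)).
  by rewrite ler_wpM2l// !mulr_ge0.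
rewrite ler_wpM2r// (_ : xi ^+ (4 * k) = xi ^+ k * xi ^+ k * xi ^+ k * xi ^+ k).
  by rewrite !ler_pM// !mulr_ge0.
by rewrite -!exprD; congr (_ ^+ _); lia.
Qed.

End function_space.

(** The form in which matches produce it: two words of x, at times t1 and t2, and two words of y, at
    t3 and t4, both points being drawn from the same sample measure. *)
Definition pair_mixing_at_level (k L : nat) (e : R) : Prop :=
  forall C1 C2 C3 C4, cylinder_or_full k C1 -> cylinder_or_full k C2 ->
    cylinder_or_full k C3 -> cylinder_or_full k C4 ->
  forall t1 t2 t3 t4, (L <= t1)%N -> (t1 + k + L <= t2)%N ->
    (t2 + k + L <= t3)%N -> (t3 + k + L <= t4)%N ->
  `|\int[P]_w (sample_prob (t1 .-shift C1 `&` t2 .-shift C2) w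
               * sample_prob (t3 .-shift C3 `&` t4 .-shift C4) w)
    - marginal_prob C1 * marginal_prob C2 * marginal_prob C3 * marginal_prob C4|
  <= e.

(** Each of the two sample measures of intersections factorises along the orbit at cost 2e, by (2)
    applied twice; what remains is the integral treated by [mixing_at_level]. *)
Lemma pair_mixing (alpha : nat -> R) k L e e4 :
  0 <= e -> fibre_mixing P theta mu alpha ->
  (forall g, (L <= g)%N -> `|alpha g| <= e) -> mixing_at_level k L e4 ->
  pair_mixing_at_level k L (4 * e + e4).
Proof.
move=> e0 fm ae mix C1 C2 C3 C4 c1 c2 c3 c4 t1 t2 t3 t4 l1 l2 l3 l4.
have d1 := cylinder_or_full_depends c1; have d2 := cylinder_or_full_depends c2.
have d3 := cylinder_or_full_depends c3; have d4 := cylinder_or_full_depends c4.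
have dS (t : nat) C : depends k C -> depends (t + k) (t .-shift C).
  by move=> dC; exact: depends_shift.
have s01 t w C : depends k C -> 0 <= sample_prob C (iter t theta w) <= 1.
  by move=> /depends_measurable mC; rewrite sample_prob_ge0 sample_prob_le1.
have bm t C : depends k C ->
    bounded_measurable (fun w => sample_prob C (iter t theta w)).
  move=> /depends_measurable mC; apply: bounded_measurable_iter.
  exact: bounded_measurable_sample_prob.
have mS t C : depends k C -> measurable (t .-shift C).
  by move=> dC; exact: (depends_measurable (dS _ _ dC)).
rewrite (le_trans (ler_distD (\int[P]_w (sample_prob C1 (iter t1 theta w)
   * sample_prob C2 (iter t2 theta w) * sample_prob C3 (iter t3 theta w)
   * sample_prob C4 (iter t4 theta w))) _ _))// lerD//; last exact: mix.
apply: expectation_dist; first by rewrite mulr_ge0.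
- by apply: bounded_measurableM; apply: bounded_measurable_sample_prob;
    apply: measurableI; exact: mS.
- by do !apply: bounded_measurableM; exact: bm.
have dT : depends 0 (setT : set (seqspace N)) by exact: dependsT.
have F1 := fibre_mixing_sample_prob fm ae dT d1 l1.
have F2 := fibre_mixing_sample_prob fm ae (dS t1 _ d1) d2 l2.
have l3' : (0 + L <= t3)%N by lia.
have F3 := fibre_mixing_sample_prob fm ae dT d3 l3'.
have F4 := fibre_mixing_sample_prob fm ae (dS t3 _ d3) d4 l4.
apply: filterS2 (filterI F1 F2) (filterI F3 F4) => w [f1 f2] [f3 f4].
rewrite sample_probT mul1r setTI in f1; rewrite sample_probT mul1r setTI in f3.
have g2 := dist_mul_chain (s01 _ _ _ d2) f1 f2.
have g4 := dist_mul_chain (s01 _ _ _ d4) f3 f4.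
set a := sample_prob (t1 .-shift C1 `&` t2 .-shift C2) w in g2 *.
set b := sample_prob (t3 .-shift C3 `&` t4 .-shift C4) w in g4 *.
have b0 : 0 <= b by exact: sample_prob_ge0.
have b1 : b <= 1 by apply: sample_prob_le1; apply: measurableI; exact: mS.
have [/andP[x10 x11] /andP[x20 x21]] := (s01 t1 w _ d1, s01 t2 w _ d2).
set x1 := sample_prob C1 _ in x10 x11 g2 *; set x2 := sample_prob C2 _ in x20 x21 g2 *.
set x3 := sample_prob C3 _ in g4 *; set x4 := sample_prob C4 _ in g4 *.
have -> : a * b - x1 * x2 * x3 * x4 = (a - x1 * x2) * b + (x1 * x2) * (b - x3 * x4) by ring.
rewrite (_ : 4 * e = (e + e) + (e + e)); last by ring.
rewrite (le_trans (ler_normD _ _))// lerD// normrM.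
  by rewrite (ger0_norm b0) (le_trans _ g2)// ler_piMr.
by rewrite (@ger0_norm _ (x1 * x2)) ?mulr_ge0// (le_trans _ g4)// ler_piMl// mulr_ile1.
Qed.

End mixing.

(** * Mixing errors below any prescribed exponential *)

Section rates.
Context {R : realType}.

Lemma expr_small (a c : R) : 0 <= a < 1 -> 0 < c ->
  exists2 K : nat, (0 < K)%N & a ^+ K <= c.
Proof.
move=> /andP[a0 a1] c0.
have an : `|a| < 1 by rewrite ger0_norm.
have /cvgr0Pnorm_le/(_ c c0)[K _ HK] := cvg_expr an.
exists K.+1 => //; have := HK K.+1 (leqnSn K).
by rewrite ger0_norm// exprn_ge0.
Qed.

Lemma bigO_expr_bound (a : R) (alpha : nat -> R) : 0 <= a < 1 ->
  alpha =O_\oo (fun g : nat => a ^+ g) ->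
  exists D g0, 0 <= D /\ forall g, (g0 <= g)%N -> `|alpha g| <= D * a ^+ g.
Proof.
move=> /andP[a0 a1] /eqO_exP[D D0 [g0 _ H]].
exists D, g0; split=> [|g gg0]; first exact: ltW.
by rewrite (le_trans (H g gg0))//= ger0_norm// exprn_ge0.
Qed.

End rates.

Section exponential_rate.
Context {d : measure_display} {Omega : measurableType d} {R : realType}.
Variables (P : probability Omega R) (theta : Omega -> Omega) (N : nat).
Variable mu : R.-pker Omega ~> seqspace N.
Variables (a : R) (alpha rho : nat -> R).
Variables (V : completeNormedModType R) (iota : {linear V -> (Omega -> R^o)}).
Hypothesis Hmps : invertible_ergodic_mps P theta.
Hypothesis Ha : 0 <= a < 1.
Hypothesis Halpha : alpha =O_\oo (fun g : nat => a ^+ g).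
Hypothesis Hrho : rho =O_\oo (fun g : nat => a ^+ g).
Hypothesis Hmix :
     [/\ marginal_mixing P mu alpha, fibre_mixing P theta mu alpha,
         mixing3 P theta iota rho & cylinder_regularity iota mu]
  \/ [/\ marginal_self_mixing P mu alpha, fibre_mixing P theta mu alpha,
         mixing4 P theta iota rho & cylinder_regularity iota mu].

(** With $a^K \le r/\xi^4$ a gap of length Kk gives $\xi^{4k} a^{Kk} \le r^k$, so the gap pays for
    the growth of the norms and leaves the rate r. *)
Lemma pair_mixing_exponential (r : R) : 0 < r -> exists K k0 D,
  [/\ (0 < K)%N, 0 <= D &
   forall k, (k0 <= k)%N -> pair_mixing_at_level P mu k (K * k) (D * r ^+ k)].
Proof.
move=> r0; have /andP[a0 a1] := Ha.
have [D1 [g1 [D10 aD]]] := bigO_expr_bound Ha Halpha.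
have [D2 [g2 [D20 rD]]] := bigO_expr_bound Ha Hrho.
have [fm reg] : fibre_mixing P theta mu alpha /\ cylinder_regularity iota mu.
  by case: Hmix => [] [].
have [xi xi1 nreg] := cylinder_regularity_norm reg.
have xi0 : 0 < xi by exact: lt_le_trans xi1.
have [K K0 Kr] := expr_small Ha (divr_gt0 r0 (exprn_gt0 4 xi0)).
pose D := D1 + D2; have D0 : 0 <= D by rewrite addr_ge0.
(* 12 = 4 + 8: the cost of [pair_mixing] and the larger of the two fourfold errors. The 1 in the
   threshold makes the gap [K * k] positive. *)
exists K, (maxn 1 (maxn g1 g2)), (12 * D); split=> // [|k].
  by rewrite mulr_ge0.
rewrite !geq_max => /and3P[k1 kg1 kg2].
have kK : (k <= K * k)%N by rewrite leq_pmull.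
pose e := D * a ^+ (K * k).
have e0 : 0 <= e by rewrite mulr_ge0// exprn_ge0.
have mono g : (K * k <= g)%N -> a ^+ g <= a ^+ (K * k).
  by move=> Kg; rewrite ler_wiXn2l// ltW.
have ae g : (K * k <= g)%N -> `|alpha g| <= e.
  move=> Kg; rewrite (le_trans (aD _ _))//; first lia.
  by rewrite ler_pM ?exprn_ge0 ?mono// lerDl.
have re g : (K * k <= g)%N -> `|rho g| <= e.
  move=> Kg; rewrite (le_trans (rD _ _))//; first lia.
  by rewrite ler_pM ?exprn_ge0 ?mono// lerDr.
have x1 : 1 <= xi ^+ (4 * k) by rewrite exprn_ege1.
have bound : xi ^+ (4 * k) * e <= D * r ^+ k.
  rewrite /e mulrCA ler_wpM2l// !exprM -exprMn lerXn2r ?nnegrE//.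
  - by rewrite mulr_ge0// exprn_ge0// ltW.
  - exact: ltW.
  - by rewrite mulrC -ler_pdivlMr// exprn_gt0.
have ebound : e <= D * r ^+ k by rewrite (le_trans _ bound)// ler_peMl.
have [e4 e4le mix] : exists2 e4, e4 <= 8 * (D * r ^+ k) &
    mixing_at_level P theta mu k (K * k) e4.
  case: Hmix => [[mm _ _ _]|[_ _ m4 _]].
    exists (8 * e); first by rewrite ler_pM2l.
    exact: mixing_at_level_marginal mm fm.
  exists (xi ^+ (4 * k) * e); last first.
    apply: (mixing_at_level_mixing4 Hmps e0 _ re m4 xi1 (nreg k)).
    by rewrite muln_gt0 K0.
  rewrite (le_trans bound)// ler_peMl// ?ler1n// mulr_ge0// exprn_ge0// ltW//.
move=> C1 C2 C3 C4 c1 c2 c3 c4 t1 t2 t3 t4 l1 l2 l3 l4.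
apply: le_trans (pair_mixing Hmps e0 fm ae mix c1 c2 c3 c4 l1 l2 l3 l4) _.
lra.
Qed.

End exponential_rate.

(** * Equivariance of the sample measures under the shift *)

Section invariance.
Context {d : measure_display} {Omega : measurableType d} {R : realType}.
Variables (P : probability Omega R) (theta : Omega -> Omega) (N : nat).
Variables (b : Omega -> nat) (A : Omega -> 'M[bool]_N.+1).
Variable nu : probability (Omega * seqspace N)%type R.
Variable mu : R.-pker Omega ~> seqspace N.
Hypothesis Hmps : invertible_ergodic_mps P theta.
Hypothesis Hnu : invariant_on_bundle P theta b A nu.
Hypothesis Hmu : sample_measures P theta b A nu mu.

Lemma nu_rectangle E (C : set (seqspace N)) : measurable E -> measurable C ->
  nu (E `*` C) = (\int[P]_(w in E) mu w C)%E.
Proof.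
move=> mE mC; rewrite (sm_decomposition Hmu); last exact: measurableX.
rewrite [RHS]integral_mkcond; apply: eq_integral => w _.
rewrite patchE; have [wE|wE] := boolP (w \in E).
  by rewrite in_xsectionX.
by rewrite notin_xsectionX// measure0.
Qed.

(** Both sides have the same integral over every measurable E. Since theta is invertible, $E \times
    \sigma^{-1}C$ is the preimage under S of $\theta E \times C$, so invariance of nu applies; a
    change of variables by theta returns to E. *)
Lemma sample_prob_shift1 n (C : set (seqspace N)) : depends n C ->
  {ae P, forall w, sample_prob mu (@shift N @^-1` C) w
                   = sample_prob mu C (theta w)}.
Proof.
move=> dC; have mC := depends_measurable dC.
have mSC : measurable (@shift N @^-1` C).
  exact: (depends_measurable (depends_shift (t := 1) dC)).
have mth := mps_measurable Hmps.
have [theta' [thK thK' mth']] := mps_invertible Hmps.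
have mmu (B : set (seqspace N)) : measurable B ->
    measurable_fun setT (fun w => mu w B).
  by move=> mB; exact: measurable_kernel.
suff : ae_eq P setT (fun w => mu w (@shift N @^-1` C)) (fun w => mu (theta w) C).
  by apply: filterS => w /= /(_ I) H; rewrite /sample_prob H.
apply: integral_ae_eq => //.
- have -> : (fun w => mu w (@shift N @^-1` C)) =
      EFin \o sample_prob mu (@shift N @^-1` C).
    by apply/funext => w /=; rewrite sample_probE.
  by apply: bounded_measurable_integrable; exact: bounded_measurable_sample_prob.
- by apply: (measurableT_comp (mmu _ mC) mth).
move=> E _ mE.
have EE : E = theta @^-1` (theta' @^-1` E).
  by apply/seteqP; split=> w /=; rewrite thK.
have mE' : measurable (theta' @^-1` E) by rewrite -[X in measurable X]setTI; exact: mth'.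
rewrite -nu_rectangle// {1}EE.
have -> : (theta @^-1` (theta' @^-1` E)) `*` (@shift N @^-1` C) =
  @skew _ Omega theta N @^-1` ((theta' @^-1` E) `*` C) by [].
rewrite (inv_skew Hnu); last exact: measurableX.
rewrite nu_rectangle// {2}EE.
transitivity (\int[pushforward P theta]_(w in theta' @^-1` E) mu w C)%E.
  apply: eq_measure_integral => B mB _; rewrite -[LHS](mps_preserving Hmps)//.
rewrite ge0_integral_pushforward//.
by apply: measurable_funTS; exact: mmu.
Qed.

Lemma sample_prob_shift t n (C : set (seqspace N)) : depends n C ->
  {ae P, forall w, sample_prob mu (t .-shift C) w
                   = sample_prob mu C (iter t theta w)}.
Proof.
elim: t n C => [|t IH] n C dC; first exact: aeW.
have := ae_comp (mps_measurable Hmps) (mps_preserving Hmps) (IH _ _ dC).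
have := sample_prob_shift1 (depends_shift (t := t) dC).
apply: filterS2 => w h1 h2.
have -> : t.+1 .-shift C = @shift N @^-1` (t .-shift C).
  by apply/seteqP; split=> x /=; rewrite -iterSr.
by rewrite h1 h2 -iterSr.
Qed.

End invariance.

Section finite_unions.

Lemma measure_finType_bigcup {d : measure_display} {T : measurableType d}
    {R : realType} (Q : {measure set T -> \bar R}) (I : finType)
    (F : I -> set T) : (forall i, measurable (F i)) ->
  (forall i j, i != j -> F i `&` F j = set0) ->
  Q (\bigcup_(i in [set: I]) F i) = (\sum_i Q (F i))%E.
Proof.
move=> mF tF; rewrite measure_fin_bigcup//.
  rewrite [RHS]fsbig_seq ?index_enum_uniq//; apply: eq_fsbigl.
  by apply/seteqP; split=> i //= _; rewrite mem_index_enum.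
- exact: finite_finset.
- by move=> i j _ _ FF; apply/eqP; apply: contraT => /tF FF0; case: FF; rewrite FF0.
Qed.

(** Disjointness of the first sides alone makes the rectangles disjoint. Match events are of this
    kind, with one rectangle for each word or pair of words. *)
Lemma product_rectangles {d : measure_display} {T : measurableType d}
    {R : realType} (m : probability T R) (I : finType) (F G : I -> set T) :
  (forall i, measurable (F i)) -> (forall i, measurable (G i)) ->
  (forall i j, i != j -> F i `&` F j = set0) ->
  fine ((m \x m)%E (\bigcup_(i in [set: I]) (F i `*` G i))) =
  \sum_i fine (m (F i)) * fine (m (G i)).
Proof.
move=> mF mG tF.
have mFG i : measurable (F i `*` G i) by exact: measurableX.
rewrite measure_finType_bigcup//; last first.
  move=> i j ij; rewrite -subset0 => -[x y] /= [[Fx _] [Fjx _]].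
  by have : (F i `&` F j) x by []; rewrite tF.
rewrite (eq_bigr (fun i => (fine (m (F i)) * fine (m (G i)))%:E)).
  by rewrite sumEFin.
move=> i _; rewrite EFinM !fineK ?fin_num_measure//.
exact: product_measure1E.
Qed.

End finite_unions.

(** * Matches *)

Section matches.
Variable N : nat.
Implicit Types p : seqspace N * seqspace N.

(** Agreement of the two words, split according to their common value u: measurability and product
    measure can be read off this form, while [match_setP] gives the coordinates. *)
Definition match_set k i j : set (seqspace N * seqspace N) :=
  \bigcup_(u in [set: k.-tuple 'I_N.+1])
    (i .-shift (cylinder u) `*` j .-shift (cylinder u)).

Lemma match_setP k i j p : match_set k i j p <->
  forall l, (l < k)%N -> p.1 (l + i)%N = p.2 (l + j)%N.
Proof.
split=> [[u _ [/= ui uj]] l lk|H].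
  have := ui (Ordinal lk); have := uj (Ordinal lk).
  by rewrite !iter_shift /= => -> ->.
exists [tuple p.1 (l + i)%N | l < k] => //; split=> l; rewrite iter_shift tnth_mktuple//.
by rewrite H.
Qed.

Lemma measurable_shift_cylinder t k (u : k.-tuple 'I_N.+1) :
  measurable (t .-shift (cylinder u) : set (seqspace N)).
Proof. exact: (depends_measurable (depends_shift (@depends_cylinder _ _ u))). Qed.

Lemma measurable_match_set k i j : measurable (match_set k i j).
Proof.
apply: fin_bigcup_measurable => [|u _]; first exact: finite_finset.
by apply: measurableX; exact: measurable_shift_cylinder.
Qed.

Lemma cylinder_disjoint t k (u v : k.-tuple 'I_N.+1) : u != v ->
  t .-shift (cylinder u) `&` t .-shift (cylinder v) = set0 :> set (seqspace N).
Proof.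
move=> uv; rewrite -subset0 => x [/= xu xv]; case/eqP: uv.
by apply: eq_from_tnth => i; rewrite -xu -xv.
Qed.


(** [longest_match n] inspects positions 1 to n, and its offsets precede the first letter compared.
    A word starting at i therefore has offset i - 1 and ends at i + k - 1, which must not exceed
    n. *)
Lemma longest_match_ge k n i j p : (0 < i)%N -> (0 < j)%N ->
  (i + k <= n.+1)%N -> (j + k <= n.+1)%N -> match_set k i j p ->
  (k <= longest_match n p.1 p.2)%N.
Proof.
move=> i0 j0 ik jk /match_setP H.
have kn : (k < n.+1)%N by lia.
rewrite /longest_match (bigop.bigmax_sup (Ordinal kn))//=.
have i' : (i.-1 < (n - k).+1)%N by lia.
have j' : (j.-1 < (n - k).+1)%N by lia.
apply/existsP; exists (Ordinal i'); apply/existsP; exists (Ordinal j').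
apply/forallP => l; apply/eqP => /=; have := H l (ltn_ord l).
by congr (_ = _); congr (_ _); lia.
Qed.

(** A longer match contains one of length k with the same start. The range n + 1 for both offsets is
    generous, but does not depend on the length of the match. *)
Lemma longest_match_lt k n p : (k <= longest_match n p.1 p.2)%N ->
  exists i j : 'I_n.+1, match_set k i.+1 j.+1 p.
Proof.
case: k => [|k] kM.
  by exists ord0, ord0; apply/match_setP.
suff [m km /existsP[i /existsP[j /forallP H]]] : exists2 m : 'I_n.+1, (k < m)%N &
   [exists i : 'I_(n - m).+1, exists j : 'I_(n - m).+1,
     forall k : 'I_m, p.1 (i + k.+1)%N == p.2 (j + k.+1)%N].
  have ii : (i < n.+1)%N by have := ltn_ord i; lia.
  have jj : (j < n.+1)%N by have := ltn_ord j; lia.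
  exists (Ordinal ii), (Ordinal jj); apply/match_setP => l lk /=.
  have lm : (l < m)%N by lia.
  have /eqP/= := H (Ordinal lm).
  by congr (_ = _); congr (_ _); lia.
apply: contrapT => nH; move: kM; apply/negP; rewrite -leqNgt.
apply/bigmax_leqP => m Hm; rewrite leqNgt; apply/negP => km.
by apply: nH; exists m.
Qed.

Lemma longest_match_le m n p : (m <= n)%N ->
  (longest_match m p.1 p.2 <= longest_match n p.1 p.2)%N.
Proof.
move=> mn; apply/bigmax_leqP => l /existsP[i /existsP[j /forallP H]].
have ln : (l < n.+1)%N by have := ltn_ord l; lia.
rewrite /longest_match (bigop.bigmax_sup (Ordinal ln))//=.
have i' : (i < (n - l).+1)%N by have := ltn_ord i; lia.
have j' : (j < (n - l).+1)%N by have := ltn_ord j; lia.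
apply/existsP; exists (Ordinal i'); apply/existsP; exists (Ordinal j').
exact/forallP.
Qed.

End matches.

(** * Probabilities of matches under the product of a sample measure with itself *)

Section fibre_probability.
Context {d : measure_display} {Omega : measurableType d} {R : realType}.
Context {N : nat}.
Variable mu : R.-pker Omega ~> seqspace N.

(** A name for [mu w] to which the structure of a probability is attached, so that its square can be
    used as a probability on pairs. *)
Definition fibre_probability (w : Omega) : set (seqspace N) -> \bar R := mu w.

HB.instance Definition _ w := Measure.on (fibre_probability w).

HB.instance Definition _ w :=
  Measure_isProbability.Build _ _ _ (fibre_probability w) (prob_kernel w).

Definition pair_probability (w : Omega) :
    probability (seqspace N * seqspace N)%type R :=
  (fibre_probability w \x fibre_probability w)%E.

Local Notation sp := (sample_prob mu).

Lemma match_prob k i j w :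
  fine (pair_probability w (match_set k i j)) =
  \sum_(u : k.-tuple 'I_N.+1)
    sp (i .-shift (cylinder u)) w * sp (j .-shift (cylinder u)) w.
Proof.
apply: (product_rectangles (fibre_probability w)) => [u|u|u v].
- exact: measurable_shift_cylinder.
- exact: measurable_shift_cylinder.
- exact: cylinder_disjoint.
Qed.

(** A position shared in x forces the same word in both matches, so a single sum over words remains;
    it is the source of the third powers of mu(C). *)
Lemma match_prob_same_left k i j j' w :
  fine (pair_probability w (match_set k i j `&` match_set k i j')) =
  \sum_(u : k.-tuple 'I_N.+1) sp (i .-shift (cylinder u)) w
    * sp (j .-shift (cylinder u) `&` j' .-shift (cylinder u)) w.
Proof.
rewrite -(product_rectangles (fibre_probability w)) => [|u|u|u v].
- congr (fine (pair_probability w _)); apply/seteqP; split=> p.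
    move=> [[u _ [/= ui uj]] [v _ [/= vi vj]]].
    have [uv|/(cylinder_disjoint i)] := eqVneq u v.
      by subst v; exists u.
    by rewrite -subset0 => /(_ p.1); case.
  by move=> [u _ [/= ui [uj uj']]]; split; exists u.
- exact: measurable_shift_cylinder.
- by apply: measurableI; exact: measurable_shift_cylinder.
- exact: cylinder_disjoint.
Qed.

Lemma match_prob_same_right k i i' j w :
  fine (pair_probability w (match_set k i j `&` match_set k i' j)) =
  \sum_(u : k.-tuple 'I_N.+1)
    sp (i .-shift (cylinder u) `&` i' .-shift (cylinder u)) w
    * sp (j .-shift (cylinder u)) w.
Proof.
rewrite -(product_rectangles (fibre_probability w)) => [|u|u|u v uv].
- congr (fine (pair_probability w _)); apply/seteqP; split=> p.
    move=> [[u _ [/= ui uj]] [v _ [/= vi vj]]].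
    have [uv|/(cylinder_disjoint j)] := eqVneq u v.
      by subst v; exists u.
    by rewrite -subset0 => /(_ p.2); case.
  by move=> [u _ [/= [ui ui'] uj]]; split; exists u.
- by apply: measurableI; exact: measurable_shift_cylinder.
- exact: measurable_shift_cylinder.
- by rewrite setIACA (cylinder_disjoint i uv) set0I.
Qed.

Lemma match_prob_pair k i i' j j' w :
  fine (pair_probability w (match_set k i j `&` match_set k i' j')) =
  \sum_(u : k.-tuple 'I_N.+1) \sum_(v : k.-tuple 'I_N.+1)
    sp (i .-shift (cylinder u) `&` i' .-shift (cylinder v)) w
    * sp (j .-shift (cylinder u) `&` j' .-shift (cylinder v)) w.
Proof.
rewrite pair_bigA/=.
rewrite -(@product_rectangles _ _ _ (fibre_probability w) _
  (fun uv : k.-tuple 'I_N.+1 * k.-tuple 'I_N.+1 =>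
     i .-shift (cylinder uv.1) `&` i' .-shift (cylinder uv.2))
  (fun uv => j .-shift (cylinder uv.1) `&` j' .-shift (cylinder uv.2)))
  => [|[u v]|[u v]|[u v] [u' v'] uv].
- congr (fine (pair_probability w _)); apply/seteqP; split=> p.
    by move=> [[u _ [/= ui uj]] [v _ [/= vi vj]]]; exists (u, v).
  by move=> [[u v] _ [/= [ui vi] [uj vj]]]; split; [exists u | exists v].
- by apply: measurableI; exact: measurable_shift_cylinder.
- by apply: measurableI; exact: measurable_shift_cylinder.
- rewrite /= setIACA; have [uu|uu] := eqVneq u u'; last first.
    by rewrite (cylinder_disjoint i uu) set0I.
  have vv : v != v' by apply: contra uv => /eqP ->; rewrite uu.
  by rewrite (cylinder_disjoint i' vv) setI0.
Qed.

End fibre_probability.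

(* The first word starts at one of the first T block times and the second word
   at one of the next T. Distinct block times are separated by a mixing gap, so
   two pairs of positions are either mixing or share a coordinate, and h_0 plays
   no role in the lower bound. *)
Section blocks.
Variables (N k L : nat).

(** The factor 2 leaves room for a dummy word, the full space, between consecutive blocks when fewer
    than four words are present. The shift [a.+1] keeps the first block beyond the initial gap L. *)
Definition block_time (a : nat) : nat := (2 * (k + L) * a.+1)%N.

Definition block_match T (ab : 'I_T * 'I_T) : set (seqspace N * seqspace N) :=
  match_set k (block_time ab.1) (block_time (T + ab.2)%N).

Lemma block_time_gap (a a' : nat) :
  (a < a')%N -> (block_time a + 2 * (k + L) <= block_time a')%N.
Proof. by move=> aa'; rewrite /block_time addnC -mulnS leq_mul2l ltnS aa' orbT. Qed.

Lemma block_time_ge a : (2 * (k + L) <= block_time a)%N.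
Proof. by rewrite /block_time mulnS leq_addr. Qed.

End blocks.

(** * First and second moments of the number of matches *)

Section moments.
Context {d : measure_display} {Omega : measurableType d} {R : realType}.
Variables (P : probability Omega R) (N : nat).
Variable mu : R.-pker Omega ~> seqspace N.
Variables (k L : nat) (e : R).
Hypothesis e0 : 0 <= e.
Hypothesis mix : pair_mixing_at_level P mu k L e.

Local Notation sp := (sample_prob mu).
Local Notation mp := (marginal_prob P mu).
Local Notation G := (k + L)%N.
Local Notation word := (k.-tuple 'I_N.+1).
Local Notation cyl := (@cylinder N k).

Definition collision k : R := \sum_(u : k.-tuple 'I_N.+1) mp (cylinder u) ^+ 2.

Local Notation p := (collision k).
Local Notation W := ((N.+1 ^ k)%:R : R).

Lemma sum_words_cst (c : R) : \sum_(u : word) c = W * c.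
Proof. by rewrite sumr_const card_tuple card_ord -[LHS]mulr_natl. Qed.

Lemma cylinder_cylinder_or_full (u : word) : cylinder_or_full k (cyl u).
Proof. by left; exists u. Qed.

Lemma measurable_cylinder (u : word) : measurable (cyl u : set (seqspace N)).
Proof. exact: (measurable_shift_cylinder 0). Qed.

Lemma collision_ge0 : 0 <= p.
Proof. by apply: sumr_ge0 => u _; exact: sqr_ge0. Qed.

Lemma collision_le : p <= W.
Proof.
rewrite -[leRHS]mulr1 -sum_words_cst ler_sum// => u _.
by rewrite expr_le1// ?marginal_prob_ge0// marginal_prob_le1//; exact: measurable_cylinder.
Qed.

Lemma words_ge1 : 1 <= W.
Proof. by rewrite ler1n expn_gt0. Qed.

Lemma marginal_le_sqrt_collision (u : word) : mp (cyl u) <= Num.sqrt p.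
Proof.
rewrite -(ger0_norm (marginal_prob_ge0 P mu (cyl u))) -sqrtr_sqr ler_sqrt ?collision_ge0//.
rewrite /collision (bigD1 u)//= lerDl.
by apply: sumr_ge0 => v _; exact: sqr_ge0.
Qed.

Lemma bounded_measurable_shift2 i i' (u v : word) :
  bounded_measurable (sp (i .-shift (cyl u) `&` i' .-shift (cyl v))).
Proof.
apply: bounded_measurable_sample_prob.
by apply: measurableI; exact: measurable_shift_cylinder.
Qed.

Lemma bounded_measurable_shift i (u : word) :
  bounded_measurable (sp (i .-shift (cyl u))).
Proof.
by apply: bounded_measurable_sample_prob; exact: measurable_shift_cylinder.
Qed.

(** Within x, and within y, the order of the two times is immaterial, since intersections and
    products commute. *)
Lemma pair_mixing_unordered i i' j j' C1 C2 C3 C4 :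
  cylinder_or_full k C1 -> cylinder_or_full k C2 ->
  cylinder_or_full k C3 -> cylinder_or_full k C4 ->
  (L <= i)%N -> (L <= i')%N ->
  (i + G <= i')%N \/ (i' + G <= i)%N -> (j + G <= j')%N \/ (j' + G <= j)%N ->
  (i + G <= j)%N -> (i' + G <= j)%N -> (i + G <= j')%N -> (i' + G <= j')%N ->
  `|\int[P]_w (sp (i .-shift C1 `&` i' .-shift C2) w
               * sp (j .-shift C3 `&` j' .-shift C4) w)
    - mp C1 * mp C2 * mp C3 * mp C4| <= e.
Proof.
move=> c1 c2 c3 c4 Li Li' [ii|ii] [jj|jj] ij i'j ij' i'j'.
- by apply: mix => //; lia.
- rewrite [j.-shift C3 `&` _]setIC -[_ * mp C3 * _]mulrA [mp C3 * _]mulrC mulrA.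
  by apply: mix => //; lia.
- rewrite [i.-shift C1 `&` _]setIC [mp C1 * _]mulrC.
  by apply: mix => //; lia.
- rewrite [j.-shift C3 `&` _]setIC -[_ * mp C3 * _]mulrA [mp C3 * _]mulrC mulrA.
  rewrite [i.-shift C1 `&` _]setIC [mp C1 * _]mulrC.
  by apply: mix => //; lia.
Qed.

Lemma two_fold_mixing i j (u : word) : (L <= i)%N -> (i + 2 * G <= j)%N ->
  `|\int[P]_w (sp (i .-shift (cyl u)) w * sp (j .-shift (cyl u)) w)
    - mp (cyl u) ^+ 2| <= e.
Proof.
move=> Li ij; have cu := cylinder_cylinder_or_full u.
have cT : cylinder_or_full k (setT : set (seqspace N)) by right.
(* The full space is inserted at [i + G] and [j + G], hence the distance [2 * G] required between i
   and j. *)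
have := @pair_mixing_unordered i (i + G) j (j + G) _ _ _ _ cu cT cu cT.
rewrite !preimage_setT !setIT marginal_probT !mulr1 -expr2; apply; lia.
Qed.

Lemma match_expectation i j : (L <= i)%N -> (i + 2 * G <= j)%N ->
  `|\int[P]_w fine (pair_probability mu w (match_set k i j)) - p| <= W * e.
Proof.
move=> Li ij; under eq_Rintegral do rewrite match_prob.
rewrite expectation_sum; last first.
  by move=> u; apply: bounded_measurableM; exact: bounded_measurable_shift.
rewrite -sumrB (le_trans (ler_norm_sum _ _ _))// -sum_words_cst ler_sum// => u _.
exact: two_fold_mixing.
Qed.

Lemma sum_cube_le : \sum_(u : word) mp (cyl u) ^+ 3 <= Num.sqrt p * p.
Proof.
rewrite /collision mulr_sumr ler_sum// => u _; rewrite exprS ler_wpM2r ?sqr_ge0//.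
exact: marginal_le_sqrt_collision.
Qed.

Lemma match_expectation_same_left i j j' : (L <= i)%N ->
  (i + 2 * G <= j)%N -> (i + 2 * G <= j')%N ->
  (j + G <= j')%N \/ (j' + G <= j)%N ->
  \int[P]_w fine (pair_probability mu w (match_set k i j `&` match_set k i j'))
  <= Num.sqrt p * p + W * e.
Proof.
move=> Li ij ij' jj'; under eq_Rintegral do rewrite match_prob_same_left.
rewrite expectation_sum; last first.
  move=> u; apply: bounded_measurableM; first exact: bounded_measurable_shift.
  exact: bounded_measurable_shift2.
apply: (@le_trans _ _ (\sum_(u : word) (mp (cyl u) ^+ 3 + e))); last first.
  by rewrite big_split/= sum_words_cst lerD2r sum_cube_le.
apply: ler_sum => u _; have cu := cylinder_cylinder_or_full u.
have cT : cylinder_or_full k (setT : set (seqspace N)) by right.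
have := @pair_mixing_unordered i (i + G) j j' _ _ _ _ cu cT cu cu.
rewrite !preimage_setT !setIT marginal_probT !mulr1 -expr2 -exprSr => H.
by rewrite -lerBlDl (le_trans (ler_norm _))// H//; lia.
Qed.

Lemma match_expectation_same_right i i' j : (L <= i)%N -> (L <= i')%N ->
  (i + 2 * G <= j)%N -> (i' + 2 * G <= j)%N ->
  (i + G <= i')%N \/ (i' + G <= i)%N ->
  \int[P]_w fine (pair_probability mu w (match_set k i j `&` match_set k i' j))
  <= Num.sqrt p * p + W * e.
Proof.
move=> Li Li' ij ij' jj'; under eq_Rintegral do rewrite match_prob_same_right.
rewrite expectation_sum; last first.
  move=> u; apply: bounded_measurableM; last exact: bounded_measurable_shift.
  exact: bounded_measurable_shift2.
apply: (@le_trans _ _ (\sum_(u : word) (mp (cyl u) ^+ 3 + e))); last first.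
  by rewrite big_split/= sum_words_cst lerD2r sum_cube_le.
apply: ler_sum => u _; have cu := cylinder_cylinder_or_full u.
have cT : cylinder_or_full k (setT : set (seqspace N)) by right.
have := @pair_mixing_unordered i i' j (j + G) _ _ _ _ cu cu cu cT.
rewrite !preimage_setT !setIT marginal_probT !mulr1 -expr2 -exprSr => H.
by rewrite -lerBlDl (le_trans (ler_norm _))// H//; lia.
Qed.

Lemma match_expectation_pair i i' j j' : (L <= i)%N -> (L <= i')%N ->
  (i + G <= i')%N \/ (i' + G <= i)%N -> (j + G <= j')%N \/ (j' + G <= j)%N ->
  (i + G <= j)%N -> (i' + G <= j)%N -> (i + G <= j')%N -> (i' + G <= j')%N ->
  \int[P]_w fine (pair_probability mu w (match_set k i j `&` match_set k i' j'))
  <= p ^+ 2 + W ^+ 2 * e.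
Proof.
move=> Li Li' ii jj ij i'j ij' i'j'; under eq_Rintegral do rewrite match_prob_pair.
have bm u v : bounded_measurable (fun w =>
    sp (i .-shift (cyl u) `&` i' .-shift (cyl v)) w
    * sp (j .-shift (cyl u) `&` j' .-shift (cyl v)) w).
  by apply: bounded_measurableM; exact: bounded_measurable_shift2.
rewrite expectation_sum; last by move=> u; exact: bounded_measurable_sum.
apply: (@le_trans _ _ (\sum_(u : word) \sum_(v : word)
    (mp (cyl u) ^+ 2 * mp (cyl v) ^+ 2 + e))); last first.
  under eq_bigr do rewrite big_split/= sum_words_cst -mulr_sumr.
  by rewrite big_split/= sum_words_cst mulrA -!expr2 -mulr_suml -expr2.
apply: ler_sum => u _; rewrite expectation_sum//; apply: ler_sum => v _.
have cu := cylinder_cylinder_or_full u; have cv := cylinder_cylinder_or_full v.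
have := @pair_mixing_unordered i i' j j' _ _ _ _ cu cv cu cv Li Li' ii jj ij i'j ij' i'j'.
rewrite -(mulrA (_ * _) _ (mp _)) mulrACA -!expr2 => H.
by rewrite -lerBlDl (le_trans (ler_norm _)).
Qed.

Lemma bounded_measurable_match_pair i i' j j' : bounded_measurable (fun w =>
  fine (pair_probability mu w (match_set k i j `&` match_set k i' j'))).
Proof.
under eq_fun do rewrite match_prob_pair.
do 2 apply: bounded_measurable_sum => ?.
by apply: bounded_measurableM; exact: bounded_measurable_shift2.
Qed.

Lemma bounded_measurable_match i j : bounded_measurable (fun w =>
  fine (pair_probability mu w (match_set k i j))).
Proof.
have := bounded_measurable_match_pair i i j j.
by under eq_fun do rewrite setIid.
Qed.

Lemma block_match_expectation T (x : 'I_T * 'I_T) :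
  `|\int[P]_w fine (pair_probability mu w (block_match k L x)) - p| <= W * e.
Proof.
apply: match_expectation; first by have := block_time_ge k L x.1; lia.
by apply: block_time_gap; have := ltn_ord x.1; lia.
Qed.

(* The second moment is dominated by p ^+ 2; pairs of positions sharing one
   coordinate contribute sum_C mu(C)^3, bounded by p^(3/2). *)
Lemma block_match_pair_expectation T (x y : 'I_T * 'I_T) :
  \int[P]_w fine (pair_probability mu w (block_match k L x `&` block_match k L y)) <=
  (p ^+ 2 + W ^+ 2 * e)
  + ((x.1 == y.1)%:R + (x.2 == y.2)%:R) * (Num.sqrt p * p + W * e)
  + ((x.1 == y.1) && (x.2 == y.2))%:R * (p + W * e).
Proof.
have p0 := collision_ge0; have s0 := sqrtr_ge0 p; have w1 := words_ge1.
have W0 : 0 <= W by rewrite (le_trans _ w1).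
have A0 : 0 <= p ^+ 2 + W ^+ 2 * e by rewrite addr_ge0 ?mulr_ge0// exprn_ge0.
have B0 : 0 <= Num.sqrt p * p + W * e by rewrite addr_ge0 ?mulr_ge0.
have C0 : 0 <= p + W * e by rewrite addr_ge0 ?mulr_ge0.
case: x y => [a b'] [a' b]; rewrite /block_match/=.
have Lt c : (L <= block_time k L c)%N by have := block_time_ge k L c; lia.
have cross (c c' : 'I_T) : (block_time k L c + 2 * G <= block_time k L (T + c'))%N.
  by apply: block_time_gap; have := ltn_ord c; lia.
have crossG (c c' : 'I_T) : (block_time k L c + G <= block_time k L (T + c'))%N.
  by rewrite (leq_trans _ (cross c c'))// leq_add2l leq_pmull.
have sep c c' : c != c' -> (block_time k L c + G <= block_time k L c')%N \/
    (block_time k L c' + G <= block_time k L c)%N.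
  rewrite neq_ltn => /orP[] /(block_time_gap k L); [left|right]; lia.
have c1 := cross a b'; have c2 := cross a b; have c3 := cross a' b'.
have c4 := cross a' b.
have [<-|aa] := eqVneq a a'; have [<-|bb] := eqVneq b' b => /=.
- rewrite setIid; have := match_expectation (Lt a) c1.
  by move=> /(le_trans (ler_norm _)); lra.
- have sb : (T + b' != T + b)%N by rewrite eqn_add2l.
  have := match_expectation_same_left (Lt a) c1 c2 (sep _ _ sb); lra.
- have := match_expectation_same_right (Lt a) (Lt a') c1 c3 (sep _ _ aa); lra.
- have sb : (T + b' != T + b)%N by rewrite eqn_add2l.
  rewrite !(add0r, mul0r, addr0).
  by apply: match_expectation_pair => //; first [exact: sep | exact: crossG].
Qed.

Lemma sum_blocks_cst T (c : R) : \sum_(x : 'I_T * 'I_T) c = T%:R ^+ 2 * c.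
Proof. by rewrite sumr_const card_prod card_ord -[LHS]mulr_natl natrM expr2. Qed.

(** Among the $T^4$ choices of two position pairs, $T^3$ share the first coordinate, $T^3$ the
    second and $T^2$ both. *)
Lemma sum_pair_eq_indic T (c1 c2 c3 c4 : R) :
  \sum_(x : 'I_T * 'I_T) \sum_(y : 'I_T * 'I_T)
    (c1 + ((x.1 == y.1)%:R + (x.2 == y.2)%:R) * c2
     + ((x.1 == y.1) && (x.2 == y.2))%:R * c3) =
  T%:R ^+ 4 * c1 + 2 * T%:R ^+ 3 * c2 + T%:R ^+ 2 * c3.
Proof.
have s1 (x : 'I_T * 'I_T) : \sum_(y : 'I_T * 'I_T) ((x.1 == y.1)%:R : R) = T%:R.
  rewrite -(pair_bigA _ (fun a b => (x.1 == a)%:R))/= (bigD1 x.1)//= [X in _ + X]big1.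
    by rewrite addr0 eqxx sumr_const card_ord.
  by move=> a; rewrite eq_sym => /negbTE ->; rewrite big1.
have s2 (x : 'I_T * 'I_T) : \sum_(y : 'I_T * 'I_T) ((x.2 == y.2)%:R : R) = T%:R.
  rewrite -(pair_bigA _ (fun a b => (x.2 == b)%:R))/=.
  rewrite (eq_bigr (fun=> 1)) ?sumr_const ?card_ord// => a _.
  rewrite (bigD1 x.2)//= [X in _ + X]big1; first by rewrite addr0 eqxx.
  by move=> b; rewrite eq_sym => /negbTE ->.
have s3 (x : 'I_T * 'I_T) :
    \sum_(y : 'I_T * 'I_T) (((x.1 == y.1) && (x.2 == y.2))%:R : R) = 1.
  rewrite (bigD1 x)//= [X in _ + X]big1; first by rewrite addr0 !eqxx.
  move=> y; rewrite [y == x]eq_sym -pair_eqE /pair_eq/= => /negbTE ->.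
  by [].
rewrite (eq_bigr (fun=> T%:R ^+ 2 * c1 + (T%:R + T%:R) * c2 + c3)); last first.
  by move=> x _; rewrite !big_split/= -!mulr_suml big_split/= s1 s2 s3 mul1r sum_blocks_cst.
by rewrite sum_blocks_cst; ring.
Qed.

(** With $M = T^2 p$ the leading terms $T^4 p^2$ of the second moment, of the cross term and of
    $M^2$ cancel. Pairs with a shared coordinate remain, and mixing errors amounting to at most six
    times $T^4 W^2 e$. *)
Lemma no_block_match_bound T : (0 < T)%N -> 0 < p ->
  exists g : Omega -> R, [/\ bounded_measurable g,
    forall w, fine (pair_probability mu w
      [set z | forall x : 'I_T * 'I_T, ~ block_match k L x z]) <= g w &
    \int[P]_w g w * (T%:R ^+ 2 * p) ^+ 2 <=
      2 * T%:R ^+ 3 * (Num.sqrt p * p) + T%:R ^+ 2 * p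
      + 8 * T%:R ^+ 4 * W ^+ 2 * e].
Proof.
move=> T0 p0; pose M := T%:R ^+ 2 * p; pose t : R := T%:R.
have t1 : 1 <= t by rewrite ler1n.
have M0 : 0 < M by rewrite mulr_gt0// exprn_gt0// ltr0n.
pose S2 w := \sum_(x : 'I_T * 'I_T) \sum_(y : 'I_T * 'I_T)
  fine (pair_probability mu w (block_match k L x `&` block_match k L y)).
pose S1 w := \sum_(x : 'I_T * 'I_T) fine (pair_probability mu w (block_match k L x)).
have bS2 : bounded_measurable S2.
  do 2 apply: bounded_measurable_sum => ?.
  exact: bounded_measurable_match_pair.
have bS1 : bounded_measurable S1.
  by apply: bounded_measurable_sum => ?; exact: bounded_measurable_match.
pose h w := S2 w + (- (2 * M) * S1 w + M ^+ 2).
have bc c := bounded_measurable_cst c (T := Omega) (R := R).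
have bh1 : bounded_measurable (fun w => - (2 * M) * S1 w).
  exact: bounded_measurableM.
have bh2 : bounded_measurable (fun w => - (2 * M) * S1 w + M ^+ 2).
  exact: bounded_measurableD.
have bh : bounded_measurable h by exact: bounded_measurableD.
exists (fun w => M ^- 2 * h w); split; first exact: bounded_measurableM.
  move=> w; rewrite mulrC ler_pdivlMr ?exprn_gt0// mulrC.
  have := @second_moment _ _ _ (pair_probability mu w) _ (@block_match N k L T) M.
  rewrite /h addrA mulNr; apply => x; exact: measurable_match_set.
rewrite expectationZ// -/M mulrAC mulVf ?mul1r; last by rewrite expf_neq0 ?gt_eqF.
rewrite expectationD// expectationD// expectation_cst expectationZ//.
have E2 : \int[P]_w S2 w <= t ^+ 4 * (p ^+ 2 + W ^+ 2 * e)
    + 2 * t ^+ 3 * (Num.sqrt p * p + W * e) + t ^+ 2 * (p + W * e).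
  rewrite expectation_sum; last first.
    by move=> x; apply: bounded_measurable_sum => y; exact: bounded_measurable_match_pair.
  rewrite -sum_pair_eq_indic// ler_sum// => x _; rewrite expectation_sum; last first.
    by move=> y; exact: bounded_measurable_match_pair.
  by apply: ler_sum => y _; exact: block_match_pair_expectation.
have E1 : t ^+ 2 * (p - W * e) <= \int[P]_w S1 w.
  rewrite expectation_sum; last by move=> x; exact: bounded_measurable_match.
  rewrite -sum_blocks_cst.
  apply: ler_sum => x _; have := block_match_expectation x.
  by rewrite ler_norml => /andP[]; lra.
have E1M : 2 * M * (t ^+ 2 * (p - W * e)) <= 2 * M * \int[P]_w S1 w.
  by rewrite ler_wpM2l// mulr_ge0// ltW.
have w1 := words_ge1; have W0 : 0 <= W by rewrite (le_trans _ w1).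
have We0 : 0 <= W * e by rewrite mulr_ge0.
have We : W * e <= W ^+ 2 * e by rewrite ler_wpM2r// ler_eXnr.
have t30 : 0 <= t ^+ 3 by rewrite exprn_ge0// (le_trans _ t1).
have t43 : t ^+ 3 <= t ^+ 4 by rewrite ler_weXn2l.
have t42 : t ^+ 2 <= t ^+ 4 by rewrite ler_weXn2l.
have X3 : t ^+ 3 * (W * e) <= t ^+ 4 * (W ^+ 2 * e) by rewrite ler_pM.
have X2 : t ^+ 2 * (W * e) <= t ^+ 4 * (W ^+ 2 * e) by rewrite ler_pM// sqr_ge0.
have X1 : t ^+ 4 * (p * (W * e)) <= t ^+ 4 * (W ^+ 2 * e).
  rewrite ler_wpM2l ?exprn_ge0 ?(le_trans _ t1)// expr2 -mulrA.
  by rewrite ler_wpM2r// collision_le.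
have MM : 2 * M * (t ^+ 2 * (p - W * e)) =
    2 * M ^+ 2 - 2 * (t ^+ 4 * (p * (W * e))) by rewrite /M; ring.
have M2 : M ^+ 2 = t ^+ 4 * p ^+ 2 by rewrite /M -/t; ring.
rewrite -/t mulNr; move: E2 E1M; rewrite MM M2 => E2 E1M.
have M1 : M = t ^+ 2 * p by [].
have X0 : 0 <= t ^+ 4 * (W ^+ 2 * e) by rewrite mulr_ge0 ?mulr_ge0 ?exprn_ge0// (le_trans _ t1).
move: X0 X1 X2 X3 E2 E1M M1; clear; move: (_ ^ k)%:R => Wk.
lra.
Qed.

End moments.

(** * Lower bound *)

Section exponential_growth.
Context {R : realType}.

Lemma linear_le_exp (C delta : R) : 0 < delta ->
  exists k0 : nat, forall k, (k0 <= k)%N -> C * k%:R <= expR (delta * k%:R).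
Proof.
(* From $\exp(\delta k) = \exp(\delta k/2)^2 \ge (\delta k/2)^2$, which is at least Ck beyond this
   threshold. *)
move=> d0; exists (Num.truncn (4 * `|C| / delta ^+ 2)).+1 => k kk.
have d2 : 0 < delta ^+ 2 by rewrite exprn_gt0.
have kC : 4 * `|C| / delta ^+ 2 <= k%:R.
  by rewrite ltW// (lt_le_trans (truncnS_gt _))// ler_nat.
rewrite ler_pdivrMr// in kC.
have E : expR (delta * k%:R) = expR (delta * k%:R / 2) ^+ 2.
  by rewrite -expRM_natl; congr expR; field.
have k0 : 0 <= k%:R :> R by [].
have half : delta * k%:R / 2 <= expR (delta * k%:R / 2).
  by apply: le_trans (expR_ge1Dx _); rewrite lerDr.
have half0 : 0 <= delta * k%:R / 2 by rewrite divr_ge0// mulr_ge0// ltW.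
rewrite E (@le_trans _ _ ((delta * k%:R / 2) ^+ 2))//; last first.
  by rewrite lerXn2r// nnegrE expR_ge0.
have -> : (delta * k%:R / 2) ^+ 2 = (k%:R * delta ^+ 2) / 4 * k%:R by field.
by rewrite ler_wpM2r// ler_pdivlMr// mulrC (le_trans _ kC)// ler_pM2l// ler_norm.
Qed.

End exponential_growth.

Section lower_bound.
Context {d : measure_display} {Omega : measurableType d} {R : realType}.
Variables (P : probability Omega R) (N : nat).
Variable mu : R.-pker Omega ~> seqspace N.
Hypothesis Hexp : forall r : R, 0 < r -> exists K k0 D,
  [/\ (0 < K)%N, 0 <= D &
   forall k, (k0 <= k)%N -> pair_mixing_at_level P mu k (K * k) (D * r ^+ k)].

(** Put $y = T\sqrt p$. Dividing by $(T^2 p)^2 = y^4$ turns the main terms into $2/y + 1/y^2$, and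
    $y \ge \exp((c_1 - c_2)k) = q^{-k}$. The equation for r says that the mixing error, summed over
    pairs of words, is at most $q^k$ times $p^2$, up to constants. *)
Lemma second_moment_decay (c1 c2 D r q : R) k L :
  0 < c2 -> 0 <= D -> 0 < r -> 0 < q < 1 -> q * expR (c1 - c2) = 1 ->
  r * (N.+1%:R ^+ 2 * expR (4 * c2)) = q ->
  pair_mixing_at_level P mu k L (D * r ^+ k) ->
  expR (- (2 * c2) * k%:R) <= collision P mu k ->
  let T := (Num.truncn (expR (c1 * k%:R))).+1 in
  exists g : Omega -> R, [/\ bounded_measurable g,
    forall w, fine (pair_probability mu w
      [set z | forall x : 'I_T * 'I_T, ~ block_match k L x z]) <= g w &
    \int[P]_w g w <= (3 + 8 * D) * q ^+ k].
Proof.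
move=> c20 D0 r0 /andP[q0 q1] qc rq mix pge T.
have p0 : 0 < collision P mu k by apply: lt_le_trans pge; exact: expR_gt0.
have e0 : 0 <= D * r ^+ k by rewrite mulr_ge0// exprn_ge0// ltW.
have [g [bg Qg H]] := no_block_match_bound e0 mix (ltn0Sn _ : (0 < T)%N) p0.
exists g; split=> //.
set p := collision P mu k in p0 pge H *; set s := Num.sqrt p in H *.
set t : R := T%:R in H *.
have s0 : 0 < s by rewrite sqrtr_gt0.
have sp : p = s ^+ 2 by rewrite sqr_sqrtr// ltW.
have t0 : 0 < t by rewrite ltr0n.
have y0 : 0 < t * s by rewrite mulr_gt0.
have qk0 : 0 < q ^+ k by rewrite exprn_gt0.
have sge : expR (- c2 * k%:R) <= s.
  rewrite -(@ger0_norm _ (expR _)) ?expR_ge0// -sqrtr_sqr (ler_sqrt _ (ltW p0)).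
  by rewrite -expRM_natl (le_trans _ pge)// ler_expR; lra.
have tge : expR (c1 * k%:R) <= t by rewrite ltW// truncnS_gt.
have qy : 1 <= q ^+ k * (t * s).
  have -> : 1 = q ^+ k * (expR (c1 * k%:R) * expR (- c2 * k%:R)) :> R.
    by rewrite -expRD -mulrDl expRM_natr -exprMn qc expr1n.
  by rewrite ler_pM2l// ler_pM// expR_ge0.
have y1 : 1 <= t * s.
  by rewrite (le_trans qy)// ler_piMl ?(ltW y0)// exprn_ile1// ltW.
have err : (N.+1 ^ k)%:R ^+ 2 * r ^+ k <= q ^+ k * p ^+ 2.
  have p2 : expR (- (4 * c2)) ^+ k <= p ^+ 2.
    rewrite -expRM_natr (_ : _ * k%:R = 2%:R * (- (2 * c2) * k%:R)); last by ring.
    by rewrite expRM_natl lerXn2r// ?nnegrE ?expR_ge0// ltW.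
  apply: le_trans (ler_wpM2l (ltW qk0) p2).
  have -> : q ^+ k * expR (- (4 * c2)) ^+ k = (r * N.+1%:R ^+ 2) ^+ k.
    by rewrite -exprMn -rq expRN mulrA mulfK// gt_eqF// expR_gt0.
  by rewrite natrX -exprM mulnC exprM -exprMn mulrC.
have y4 : 0 < (t ^+ 2 * p) ^+ 2 by rewrite exprn_gt0// mulr_gt0// exprn_gt0.
rewrite -(ler_pM2r y4) (le_trans H)//.
have E4 : (t ^+ 2 * p) ^+ 2 = (t * s) ^+ 4 by rewrite sp; ring.
have E3 : 2 * t ^+ 3 * (s * p) = 2 * (t * s) ^+ 3 by rewrite sp; ring.
have E2 : t ^+ 2 * p = (t * s) ^+ 2 by rewrite sp; ring.
have F3 : (t * s) ^+ 3 <= q ^+ k * (t * s) ^+ 4.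
  by rewrite [_ ^+ 4]exprS mulrA ler_peMl// exprn_ge0// ltW.
have F2 : (t * s) ^+ 2 <= (t * s) ^+ 3 by rewrite ler_weXn2l.
have F1 : 8 * t ^+ 4 * (N.+1 ^ k)%:R ^+ 2 * (D * r ^+ k) <= 8 * D * (q ^+ k * (t * s) ^+ 4).
  have -> : 8 * t ^+ 4 * (N.+1 ^ k)%:R ^+ 2 * (D * r ^+ k) =
    (8 * D * t ^+ 4) * ((N.+1 ^ k)%:R ^+ 2 * r ^+ k) by ring.
  have -> : 8 * D * (q ^+ k * (t * s) ^+ 4) = (8 * D * t ^+ 4) * (q ^+ k * p ^+ 2).
    by rewrite sp; ring.
  by rewrite ler_wpM2l// !mulr_ge0// exprn_ge0// ltW.
rewrite E3 {1}E2 E4.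
have -> : (3 + 8 * D) * q ^+ k * (t * s) ^+ 4 =
  3 * (q ^+ k * (t * s) ^+ 4) + 8 * D * (q ^+ k * (t * s) ^+ 4) by ring.
rewrite lerD//; lra.
Qed.

Lemma ae_longest_match_ge (c c2 : R) : 0 < c2 < c ->
  (exists k1, forall k, (k1 <= k)%N ->
     expR (- (2 * c2) * k%:R) <= collision P mu k) ->
  {ae P, forall w, {ae pair_probability mu w, forall z, exists k1, forall k,
    (k1 <= k)%N ->
    (k <= longest_match (Num.truncn (expR (c * k%:R))).+1 z.1 z.2)%N}}.
Proof.
move=> /andP[c20 c2c] [k1 Hp].
(* The margin [c - c2] is split in two: c1 - c2 gives the exponential decay, c - c1 absorbs the
   linear length of the blocks. *)
pose c1 := (c2 + c) / 2; pose delta := (c - c2) / 2.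
have d0 : 0 < delta by rewrite /delta; lra.
have n0 : 0 < (N.+1%:R : R) by rewrite ltr0n.
pose q : R := expR (- delta).
have q0 : 0 < q by exact: expR_gt0.
have q1 : q < 1 by rewrite /q -expR0 ltr_expR; lra.
have den0 : 0 < N.+1%:R ^+ 2 * expR (4 * c2) :> R.
  by rewrite mulr_gt0 ?expR_gt0// exprn_gt0.
pose r := q / (N.+1%:R ^+ 2 * expR (4 * c2)).
have r0 : 0 < r by rewrite divr_gt0.
have rq : r * (N.+1%:R ^+ 2 * expR (4 * c2)) = q by rewrite divfK// gt_eqF.
have qc : q * expR (c1 - c2) = 1.
  by rewrite -expRD -[RHS]expR0; congr expR; rewrite /delta /c1; field.
have [K [k0 [D [K0 D0 mix]]]] := Hexp r0.
(* 2T blocks of length 2(1 + K)k with $T \le 2\exp(c_1 k)$ give the first summand; the last word, of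
   length k, gives the second. *)
have [k2 Hk2] := linear_le_exp (8 * (1 + K%:R) + 1) d0.
pose T k := (Num.truncn (expR (c1 * k%:R))).+1.
pose B k : set (seqspace N * seqspace N) := [set z | forall x : 'I_(T k) * 'I_(T k),
                       ~ block_match k (K * k) x z].
have : forall k, exists g : Omega -> R, bounded_measurable g /\
    ((maxn k0 k1 <= k)%N -> (forall w, fine (pair_probability mu w (B k)) <= g w) /\
     \int[P]_w g w <= (3 + 8 * D) * q ^+ k).
  move=> k; have [kk|_] := leqP (maxn k0 k1) k; last first.
    by exists (fun=> 0); split=> //; exact: bounded_measurable_cst.
  have kk0 : (k0 <= k)%N := leq_trans (leq_maxl _ _) kk.
  have kk1 : (k1 <= k)%N := leq_trans (leq_maxr _ _) kk.
  have q01 : 0 < q < 1 by rewrite q0.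
  have [g [bg Qg Hg]] := second_moment_decay c20 D0 r0 q01 qc rq (mix k kk0) (Hp k kk1).
  by exists g.
move=> /choice[g Hg].
have mB k : measurable (B k).
  have -> : B k = \bigcap_(x in [set: 'I_(T k) * 'I_(T k)]) ~` block_match k (K * k) x.
    by apply/seteqP; split=> z /= zB x; [move=> _; exact: zB | exact: (zB x I)].
  apply: fin_bigcap_measurable => [|x _]; first exact: finite_finset.
  by apply: measurableC; exact: measurable_match_set.
have : {ae P, forall w, {ae pair_probability mu w, forall z,
    exists k1, forall k, (k1 <= k)%N -> ~ B k z}}.
  apply: (@ae_eventually_notin _ _ _ _ _ _ _ B g (3 + 8 * D) q (maxn k0 k1)).
  - by rewrite addr_ge0// mulr_ge0.
  - by rewrite q0.
  - by [].
  - by move=> k; have [] := Hg k.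
  - by move=> k w kk; have [_ /(_ kk)[]] := Hg k.
  - by move=> k kk; have [_ /(_ kk)[]] := Hg k.
apply: filterS => w; apply: filterS => z [k3 Hk3].
exists (maxn 1 (maxn k2 k3)) => k; rewrite !geq_max => /and3P[kk1 kk2 kk3].
have /existsNP[[a b] /contrapT ab] := Hk3 k kk3.
have big : (4 * T k * (k + K * k) + k <= (Num.truncn (expR (c * k%:R))).+2)%N.
  rewrite leqW// leqW// truncn_ge_nat ?expR_ge0//.
  have E : expR (c * k%:R) = expR (delta * k%:R) * expR (c1 * k%:R).
    by rewrite -expRD -mulrDl; congr expR; congr (_ * _); rewrite /delta /c1; field.
  set E1 := expR (c1 * k%:R) in E *.
  have E11 : 1 <= E1.
    by rewrite /E1 -expR0 ler_expR mulr_ge0// /c1; lra.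
  have Tle : (T k)%:R <= 2 * E1.
    have := @truncn_le R E1; rewrite expR_ge0 => H.
    by rewrite /T -/E1 -natr1; lra.
  rewrite natrD !natrM natrD natrM.
  have k0R : 0 <= k%:R :> R by [].
  have KR : 0 <= K%:R :> R by [].
  apply: (@le_trans _ _ ((8 * (1 + K%:R) + 1) * k%:R * E1)); last first.
    by rewrite E ler_wpM2r ?Hk2// (le_trans _ E11).
  have -> : (8 * (1 + K%:R) + 1) * k%:R * E1 =
     4 * (2 * E1) * (k%:R + K%:R * k%:R) + k%:R * E1 by ring.
  rewrite lerD//; last by rewrite ler_peMr.
  by rewrite ler_wpM2r ?addr_ge0 ?mulr_ge0// ler_wpM2l.
have bt m : (m < 2 * T k)%N ->
    (block_time k (K * k) m + k <= (Num.truncn (expR (c * k%:R))).+2)%N.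
  move=> mT; apply: leq_trans big; rewrite leq_add2r /block_time.
  have -> : (4 * T k * (k + K * k) = 2 * (k + K * k) * (2 * T k))%N by ring.
  by rewrite leq_mul2l mT orbT.
have bt0 m : (0 < block_time k (K * k) m)%N.
  by rewrite (leq_trans _ (block_time_ge k (K * k) m))// muln_gt0 addn_gt0 kk1.
apply: longest_match_ge ab => //=; apply: bt.
  by rewrite (leq_trans (ltn_ord a))// leq_pmull.
by rewrite mul2n -addnn ltn_add2l ltn_ord.
Qed.

End lower_bound.

(** * Upper bound *)

Section union_bound.
Context {d : measure_display} {T : measurableType d} {R : realType}.
Variable Q : probability T R.

Lemma union_bound (I : finType) (E : I -> set T) :
  (forall i, measurable (E i)) ->
  fine (Q (\bigcup_(i in [set: I]) E i)) <= \sum_i fine (Q (E i)).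
Proof.
move=> mE; have mU : measurable (\bigcup_(i in [set: I]) E i).
  by apply: fin_bigcup_measurable => // i _; exact: mE.
have bE i := bounded_measurable_indic (R := R) (mE i).
rewrite -expectation_indic//; under eq_bigr do rewrite -expectation_indic//.
rewrite -expectation_sum//; apply: expectation_le.
- exact: bounded_measurable_indic.
- exact: bounded_measurable_sum.
move=> x; rewrite indicE; case: (boolP (x \in _)) => [|_]; last first.
  by apply: sumr_ge0 => i _; rewrite indicE.
rewrite inE => -[i _ Ei]; rewrite (bigD1 i)//= indicE mem_set// lerDl.
by apply: sumr_ge0 => j _; rewrite indicE.
Qed.

End union_bound.

Section upper_bound.
Context {d : measure_display} {Omega : measurableType d} {R : realType}.
Variables (P : probability Omega R) (theta : Omega -> Omega) (N : nat).
Variable mu : R.-pker Omega ~> seqspace N.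
Hypothesis Hmps : invertible_ergodic_mps P theta.
Hypothesis Hinv : forall t n (C : set (seqspace N)), depends n C ->
  {ae P, forall w, sample_prob mu (t .-shift C) w
                   = sample_prob mu C (iter t theta w)}.
Hypothesis Hexp : forall r : R, 0 < r -> exists K k0 D,
  [/\ (0 < K)%N, 0 <= D &
   forall k, (k0 <= k)%N -> pair_mixing_at_level P mu k (K * k) (D * r ^+ k)].
Hypothesis Hmax : forall k,
  measurable_fun setT (fun w => fine (max_cylinder mu k w)).

Local Notation sp := (sample_prob mu).

Definition max_prob k (w : Omega) : R := fine (max_cylinder mu k w).

Lemma max_cylinder_ge k (u : k.-tuple 'I_N.+1) w :
  (mu w (cylinder u) <= max_cylinder mu k w)%E.
Proof. by rewrite /max_cylinder; apply: (le_bigmax _ (fun u => mu w (cylinder u))). Qed.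

Lemma max_cylinder_fin k w : max_cylinder mu k w \is a fin_num.
Proof.
rewrite fin_numE; apply/andP; split.
  (* Some word of length k exists, so the maximum is not the default -oo. *)
  rewrite gt_eqF// (lt_le_trans _ (max_cylinder_ge [tuple ord0 | i < k] w))//.
  by rewrite (lt_le_trans ltNy0).
rewrite lt_eqF// (@le_lt_trans _ _ 1%E) ?ltry//.
apply: bigmax_le => [|u _]; first exact: leNye.
by apply: mu_le1; exact: measurable_cylinder.
Qed.

Lemma max_prob_ge k (u : k.-tuple 'I_N.+1) w : sp (cylinder u) w <= max_prob k w.
Proof.
rewrite -lee_fin sample_probE; last exact: measurable_cylinder.
by rewrite /max_prob fineK ?max_cylinder_fin// max_cylinder_ge.
Qed.

Lemma max_prob_ge0 k w : 0 <= max_prob k w.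
Proof.
rewrite (le_trans _ (max_prob_ge [tuple ord0 | i < k] w))//.
exact: sample_prob_ge0.
Qed.

Lemma bounded_measurable_max_prob k : bounded_measurable (max_prob k).
Proof.
split; first exact: Hmax.
exists 1 => w; rewrite ger0_norm ?max_prob_ge0//.
rewrite -lee_fin /max_prob fineK ?max_cylinder_fin//.
apply: bigmax_le => [|u _]; first exact: leNye.
by apply: mu_le1; exact: measurable_cylinder.
Qed.

Lemma sum_shift_cylinder k j w :
  \sum_(u : k.-tuple 'I_N.+1) sp (j .-shift (cylinder u)) w <= 1.
Proof.
have mc (u : k.-tuple 'I_N.+1) : measurable (j .-shift (cylinder u) : set (seqspace N)).
  exact: measurable_shift_cylinder.
rewrite -lee_fin -sumEFin; under eq_bigr do rewrite sample_probE//.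
rewrite -measure_finType_bigcup//; last exact: cylinder_disjoint.
apply: mu_le1; apply: fin_bigcup_measurable => [|u _]; last exact: mc.
exact: finite_finset.
Qed.

(* Near the diagonal there is no mixing to use: one factor is bounded by the
   largest cylinder measure, and the others sum to at most 1. *)
Lemma match_expectation_max k i j :
  \int[P]_w fine (pair_probability mu w (match_set k i j)) <=
  \int[P]_w max_prob k w.
Proof.
rewrite -[leRHS](expectation_iter Hmps i (bounded_measurable_max_prob k)).
have bs u : bounded_measurable (sp (j .-shift (@cylinder N k u))).
  exact: bounded_measurable_shift.
have bt : bounded_measurable (fun w => \sum_(u : k.-tuple 'I_N.+1)
    sp (cylinder u) (iter i theta w) * sp (j .-shift (cylinder u)) w).
  apply: bounded_measurable_sum => u; apply: bounded_measurableM => //.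
  apply: (bounded_measurable_iter Hmps); apply: bounded_measurable_sample_prob.
  exact: measurable_cylinder.
(* Equivariance moves the shift by i from the cylinder to omega, where invariance of P removes
   it. *)
rewrite (_ : Rintegral _ _ _ = \int[P]_w \sum_(u : k.-tuple 'I_N.+1)
    sp (cylinder u) (iter i theta w) * sp (j .-shift (cylinder u)) w).
  apply: expectation_le => //.
    exact: (bounded_measurable_iter Hmps i (bounded_measurable_max_prob k)).
  move=> w; apply: (@le_trans _ _ (max_prob k (iter i theta w)
      * \sum_(u : k.-tuple 'I_N.+1) sp (j .-shift (cylinder u)) w)).
    rewrite mulr_sumr ler_sum// => u _.
    by rewrite ler_wpM2r ?sample_prob_ge0// max_prob_ge.
  by rewrite ler_piMr ?max_prob_ge0// sum_shift_cylinder.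
apply: expectation_ae_eq => //; first exact: bounded_measurable_match.
(* The null sets of all words are united by enumerating the words by natural numbers. *)
have : {ae P, forall w, forall n, match @unpickle (k.-tuple 'I_N.+1) n with
    | Some u => sp (i .-shift (cylinder u)) w = sp (cylinder u) (iter i theta w)
    | None => True end}.
  apply: ae_foralln => n; case: (unpickle n) => [u|]; last exact: aeW.
  exact: (Hinv i (@depends_cylinder _ _ u)).
apply: filterS => w H; rewrite match_prob; apply: eq_bigr => u _.
by have := H (pickle u); rewrite pickleK => ->.
Qed.

(** Averaged over omega, the law of the pair (x, y) is stationary. Matches close to the origin can
    thus be moved beyond the initial gap that mixing requires. *)
Lemma match_expectation_shift k t i j :
  \int[P]_w fine (pair_probability mu w (match_set k (i + t) (j + t))) =
  \int[P]_w fine (pair_probability mu w (match_set k i j)).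
Proof.
have bm := bounded_measurable_match mu k i j.
rewrite -[RHS](expectation_iter Hmps t bm).
apply: expectation_ae_eq => //.
- exact: bounded_measurable_match.
- exact: (bounded_measurable_iter Hmps t bm).
have : {ae P, forall w, forall n, match @unpickle (k.-tuple 'I_N.+1) n with
    | Some u => sp ((i + t) .-shift (cylinder u)) w
                = sp (i .-shift (cylinder u)) (iter t theta w)
             /\ sp ((j + t) .-shift (cylinder u)) w
                = sp (j .-shift (cylinder u)) (iter t theta w)
    | None => True end}.
  apply: ae_foralln => n; case: (unpickle n) => [u|]; last exact: aeW.
  have shD m : (m + t) .-shift (cylinder u) = t .-shift (m .-shift (cylinder u))
      :> set (seqspace N).
    by apply/seteqP; split=> x /=; rewrite iterD.
  rewrite !shD.
  have := Hinv t (depends_shift (t := i) (@depends_cylinder _ _ u)).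
  have := Hinv t (depends_shift (t := j) (@depends_cylinder _ _ u)).
  by apply: filterS2 => w -> ->.
apply: filterS => w H; rewrite !match_prob; apply: eq_bigr => u _.
by have := H (pickle u); rewrite pickleK => -[-> ->].
Qed.

Lemma match_expectation_sym k i j :
  \int[P]_w fine (pair_probability mu w (match_set k i j)) =
  \int[P]_w fine (pair_probability mu w (match_set k j i)).
Proof.
apply: eq_Rintegral => w _; rewrite !match_prob; apply: eq_bigr => u _.
exact: mulrC.
Qed.

(** Distant positions, in either order, fall under mixing after a shift by L and, if needed, an
    exchange of x and y; the indicator singles out the others, which receive the bound by the
    largest cylinder. *)
Lemma match_expectation_le k L e (i j : nat) : 0 <= e ->
  pair_mixing_at_level P mu k L e ->
  \int[P]_w fine (pair_probability mu w (match_set k i j)) <=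
  (collision P mu k + (N.+1 ^ k)%:R * e) +
  ((i < j + 2 * (k + L)) && (j < i + 2 * (k + L)))%N%:R * \int[P]_w max_prob k w.
Proof.
move=> e0 mix.
have far a b : (a + 2 * (k + L) <= b)%N ->
    \int[P]_w fine (pair_probability mu w (match_set k a b)) <=
    collision P mu k + (N.+1 ^ k)%:R * e.
  move=> ab; rewrite -(match_expectation_shift k L).
  have ab' : (a + L + 2 * (k + L) <= b + L)%N by rewrite addnAC leq_add2r.
  have := match_expectation e0 mix (leq_addl a L) ab'.
  by rewrite ler_norml => /andP[_]; lra.
have [ji|ij] := leqP (j + 2 * (k + L)) i.
  by rewrite mul0r addr0 match_expectation_sym far.
have [ij'|ji] := leqP (i + 2 * (k + L)) j.
  by rewrite mul0r addr0 far.
rewrite mul1r (le_trans (match_expectation_max k i j))// lerDr addr_ge0//.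
  exact: collision_ge0.
by rewrite mulr_ge0.
Qed.

Lemma sum_near_le n m (i : nat) :
  \sum_(j < n) ((i < j + m) && (j < i + m))%N%:R <= (2 * m)%:R :> R.
Proof.
rewrite -natr_sum ler_nat -big_mkcond/= sum1_card.
rewrite cardE -(size_map (@nat_of_ord n)) -(size_iota (i - m) (2 * m)).
apply: uniq_leq_size.
  by rewrite map_inj_uniq ?enum_uniq//; exact: ord_inj.
move=> x /mapP[j]; rewrite mem_enum unfold_in mem_iota => /andP[h1 h2] ->.
by lia.
Qed.

Lemma ae_longest_match_lt (c c2 h : R) : 0 < c -> c < c2 -> c < h ->
  (exists k1, forall k, (k1 <= k)%N ->
     collision P mu k <= expR (- (2 * c2) * k%:R)) ->
  (exists k1, forall k, (k1 <= k)%N ->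
     \int[P]_w max_prob k w <= expR (- h * k%:R)) ->
  {ae P, forall w, {ae pair_probability mu w, forall z, exists k1, forall k,
    (k1 <= k)%N ->
    (longest_match (Num.truncn (expR (c * k%:R))) z.1 z.2 < k)%N}}.
Proof.
move=> c0 cc2 ch [k1 Hp] [k2 Hm].
(* The near pairs need delta twice: once to absorb the factor k through $\delta k \le \exp(\delta
   k)$, once for the decay. *)
pose delta := Num.min (c2 - c) ((h - c) / 2).
have d0 : 0 < delta by rewrite lt_min; apply/andP; split; lra.
have dc2 : delta <= c2 - c by rewrite ge_min lexx.
have dh : delta <= (h - c) / 2 by rewrite ge_min lexx orbT.
pose q : R := expR (- delta).
have q0 : 0 < q by exact: expR_gt0.
have q1 : q < 1 by rewrite /q -expR0 ltr_expR; lra.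
(* Chosen so that $\exp(2ck)$ pairs times $(N+1)^k$ words times $r^k$ is exactly $q^k$. *)
pose r := expR (- (2 * c + delta)) / N.+1%:R.
have n0 : 0 < (N.+1%:R : R) by rewrite ltr0n.
have r0 : 0 < r by rewrite divr_gt0 ?expR_gt0.
have rn : N.+1%:R * r = expR (- (2 * c + delta)) by rewrite /r mulrC divfK ?gt_eqF.
have [K [k0 [D [K0 D0 mix]]]] := Hexp r0.
pose n k := Num.truncn (expR (c * k%:R)).
pose B k : set (seqspace N * seqspace N) :=
  \bigcup_(ab in [set: 'I_(n k).+1 * 'I_(n k).+1]) match_set k ab.1.+1 ab.2.+1.
pose g k w := \sum_(ab : 'I_(n k).+1 * 'I_(n k).+1)
  fine (pair_probability mu w (match_set k ab.1.+1 ab.2.+1)).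
have bg k : bounded_measurable (g k).
  by apply: bounded_measurable_sum => ab; exact: bounded_measurable_match.
have mB k : measurable (B k).
  apply: fin_bigcup_measurable => [|u _]; first exact: finite_finset.
  exact: measurable_match_set.
(* The 4 is the square of 2 in $n + 1 \le 2\exp(ck)$. The last term counts the near pairs, at most
   4(1 + K)k for each first position. *)
pose Cst := 4 + 4 * D + 8 * (1 + K%:R) / delta.
have : {ae P, forall w, {ae pair_probability mu w, forall z,
    exists k1, forall k, (k1 <= k)%N -> ~ B k z}}.
  apply: (@ae_eventually_notin _ _ _ _ _ _ _ B g Cst q (maxn k0 (maxn k1 k2))) => //.
  - by rewrite /Cst !addr_ge0 ?mulr_ge0 ?divr_ge0 ?addr_ge0 ?invr_ge0// ltW.
  - by rewrite q0.
  - move=> k w _; apply: union_bound => ab; exact: measurable_match_set.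
  move=> k; rewrite !geq_max => /and3P[kk0 kk1 kk2].
  have e0 : 0 <= D * r ^+ k by rewrite mulr_ge0// exprn_ge0// ltW.
  rewrite expectation_sum; last by move=> ab; exact: bounded_measurable_match.
  set p := collision P mu k; set m := \int[P]_w max_prob k w.
  have m0 : 0 <= m by apply: Rintegral_ge0 => w _; exact: max_prob_ge0.
  pose near (a b : nat) : R :=
    ((a.+1 < b.+1 + 2 * (k + K * k)) && (b.+1 < a.+1 + 2 * (k + K * k)))%N%:R.
  pose E := expR (c * k%:R).
  have E1 : 1 <= E by rewrite /E -expR0 ler_expR mulr_ge0// ltW.
  have nE : (n k).+1%:R <= 2 * E.
    have := truncn_le E; rewrite expR_ge0 => H.
    by rewrite /n -/E -natr1; lra.
  pose W : R := (N.+1 ^ k)%:R.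
  have pe0 : 0 <= p + W * (D * r ^+ k) by rewrite addr_ge0 ?collision_ge0// mulr_ge0.
  apply: (@le_trans _ _ ((n k).+1%:R ^+ 2 * (p + W * (D * r ^+ k))
      + (n k).+1%:R * (2 * (2 * (k + K * k)))%:R * m)).
    apply: (@le_trans _ _ (\sum_(ab : 'I_(n k).+1 * 'I_(n k).+1)
       ((p + W * (D * r ^+ k)) + near ab.1 ab.2 * m))).
      by apply: ler_sum => ab _; exact: match_expectation_le e0 (mix k kk0).
    rewrite big_split/= -mulr_suml sum_blocks_cst lerD2l ler_wpM2r//.
    rewrite -(pair_bigA _ (fun a b : 'I_(n k).+1 => near a b))/=.
    apply: (@le_trans _ _ (\sum_(a < (n k).+1) (2 * (2 * (k + K * k)))%:R)).
      apply: ler_sum => a _; apply: le_trans (sum_near_le (n k).+1 _ a).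
      by apply: ler_sum => b _; rewrite /near !addSn !ltnS.
    by rewrite sumr_const card_ord -[leLHS]mulr_natl.
  have qk0 : 0 < q ^+ k by rewrite exprn_gt0.
  have Eq x : expR (x * k%:R) * expR (- delta * k%:R) = expR ((x - delta) * k%:R).
    by rewrite -expRD -mulrDl.
  have k0R : 0 <= k%:R :> R by [].
  have qE : q ^+ k = expR (- delta * k%:R) by rewrite expRM_natr.
  have T1 : E ^+ 2 * p <= q ^+ k.
    rewrite (@le_trans _ _ (E ^+ 2 * expR (- (2 * c2) * k%:R)))//.
      by rewrite ler_wpM2l ?exprn_ge0 ?expR_ge0// Hp.
    rewrite -expRM_natl -expRD qE ler_expR mulrA -mulrDl ler_wpM2r//; lra.
  have T2 : E ^+ 2 * (W * (D * r ^+ k)) = D * q ^+ k.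
    have -> : E ^+ 2 * (W * (D * r ^+ k)) = D * (E ^+ 2 * (W * r ^+ k)) by ring.
    congr (_ * _); rewrite /W natrX -exprMn rn.
    rewrite -expRM_natr -expRM_natl -expRD qE; congr expR; ring.
  have T3 : delta * (k%:R * (E * m)) <= q ^+ k.
    apply: (@le_trans _ _ (expR (delta * k%:R) * (E * expR (- h * k%:R)))).
      rewrite [_ * (_ * (_ * _))]mulrA ler_pM//.
      - by rewrite mulr_ge0// ltW.
      - by rewrite mulr_ge0// (le_trans _ E1).
      - by apply: le_trans (expR_ge1Dx _); rewrite lerDr.
      - by rewrite ler_wpM2l ?Hm// (le_trans _ E1).
    rewrite -!expRD -!mulrDl qE ler_expR ler_wpM2r//; lra.
  have T3' : k%:R * (E * m) <= delta^-1 * q ^+ k.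
    by rewrite ler_pdivlMl.
  have N2 : (n k).+1%:R ^+ 2 <= 4 * E ^+ 2.
    rewrite (_ : 4 * _ = (2 * E) ^+ 2); last by ring.
    by rewrite lerXn2r ?nnegrE ?mulr_ge0 ?(le_trans _ E1).
  have S1 : (n k).+1%:R ^+ 2 * (p + W * (D * r ^+ k)) <=
      4 * (E ^+ 2 * p + E ^+ 2 * (W * (D * r ^+ k))).
    by rewrite -mulrDr mulrA ler_wpM2r.
  have S2 : (n k).+1%:R * (2 * (2 * (k + K * k)))%:R * m <=
      8 * (1 + K%:R) * (k%:R * (E * m)).
    have -> : 8 * (1 + K%:R) * (k%:R * (E * m)) =
      (2 * E) * (2 * (2 * (k + K * k)))%:R * m.
      by rewrite !natrM natrD natrM; ring.
    by rewrite ler_wpM2r// ler_wpM2r.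
  have S3 : 8 * (1 + K%:R) * (k%:R * (E * m)) <= 8 * (1 + K%:R) * (delta^-1 * q ^+ k).
    by rewrite ler_wpM2l// mulr_ge0// addr_ge0.
  rewrite T2 in S1; apply: (le_trans (lerD S1 (le_trans S2 S3))).
  have -> : Cst * q ^+ k = 4 * (q ^+ k + D * q ^+ k)
     + 8 * (1 + K%:R) * (delta^-1 * q ^+ k) by rewrite /Cst; ring.
  by rewrite lerD2r ler_wpM2l// lerD2r.
apply: filterS => w; apply: filterS => z [k3 Hk3].
exists k3 => k kk3; rewrite ltnNge; apply/negP => /longest_match_lt[i [j ij]].
by apply: (Hk3 k kk3); exists (i, j).
Qed.

End upper_bound.

(** * Entropies and rates *)

Section limits.
Context {R : realType}.
Implicit Types (u : nat -> \bar R) (v : nat -> R).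

Lemma limn_esup_lt u x : (limn_esup u < x)%E ->
  exists k0, forall k, (k0 <= k)%N -> (u k < x)%E.
Proof.
move=> /ereal_inf_lt[_ [V [k0 _ kV] <-] Vx]; exists k0 => k kk.
apply: le_lt_trans Vx; apply: ereal_sup_ubound; exists k => //.
exact: kV.
Qed.

Lemma limn_einf_gt u x : (x < limn_einf u)%E ->
  exists k0, forall k, (k0 <= k)%N -> (x < u k)%E.
Proof.
rewrite /limn_einf lteNr => /limn_esup_lt[k0 H]; exists k0 => k kk.
by have := H k kk; rewrite lteN2.
Qed.

Lemma limn_einf_ge u x k0 : (forall k, (k0 <= k)%N -> (x <= u k)%E) ->
  (x <= limn_einf u)%E.
Proof.
move=> H; rewrite /limn_einf leeNr.
apply: (@le_trans _ _ (ereal_sup ((\- u)%E @` [set k | (k0 <= k)%N]))).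
  by apply: ereal_inf_lbound; exists [set k | (k0 <= k)%N] => //; exists k0.
by apply: ge_ereal_sup => _ [k /= kk <-]; rewrite leeN2 H.
Qed.

Lemma limn_einf_ge_of_lt v (l : R) :
  (forall x, x < l -> exists n0, forall n, (n0 <= n)%N -> x <= v n) ->
  (l%:E <= limn_einf (fun n => (v n)%:E))%E.
Proof.
move=> H; apply/lee_addgt0Pr => e e0.
have [n0 Hn] := H (l - e) ltac:(lra).
rewrite -leeBlDr// -EFinB; apply: (@limn_einf_ge _ _ n0) => k kk.
by rewrite lee_fin Hn.
Qed.

Lemma cvg_of_eventually v (l : R) :
  (forall x, x < l -> exists n0, forall n, (n0 <= n)%N -> x <= v n) ->
  (forall x, l < x -> exists n0, forall n, (n0 <= n)%N -> v n <= x) ->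
  (v n)%:E @[n --> \oo] --> l%:E.
Proof.
move=> Hl Hu; apply: cvg_EFin; first exact: nearW.
apply/cvgrPdist_le => e e0.
have [n1 H1] := Hl (l - e) ltac:(lra).
have [n2 H2] := Hu (l + e) ltac:(lra).
exists (maxn n1 n2) => // n /=; rewrite geq_max => /andP[nn1 nn2].
by rewrite ler_norml; have := H1 n nn1; have := H2 n nn2; lra.
Qed.

Lemma log_rate_lt (p x : R) (k : nat) : (0 < k)%N -> 0 <= p ->
  (lne p%:E / (- k%:R)%:E < x%:E)%E -> expR (- x * k%:R) <= p.
Proof.
move=> k0 p0; have kR : 0 < k%:R :> R by rewrite ltr0n.
have kn : - k%:R != 0 :> R by rewrite oppr_eq0 gt_eqF.
rewrite inver (negbTE kn); have [->|pn0] := eqVneq p 0.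
  (* For p = 0 the rate is +oo, which contradicts the hypothesis. *)
  rewrite le0_lneNy// mulNyr sgrV sgrN gtr0_sg// EFinN mulN1e /=.
  by rewrite ltNge leey.
have pp : 0 < p by rewrite lt_neqAle eq_sym pn0.
rewrite lne_EFin// -EFinM lte_fin invrN mulrN ltrNl ltr_pdivlMr// => H.
by rewrite -[leRHS](lnK pp) ler_expR ltW.
Qed.

Lemma log_rate_gt (p x : R) (k : nat) : (0 < k)%N -> 0 <= p ->
  (x%:E < lne p%:E / (- k%:R)%:E)%E -> p <= expR (- x * k%:R).
Proof.
move=> k0 p0; have kR : 0 < k%:R :> R by rewrite ltr0n.
have kn : - k%:R != 0 :> R by rewrite oppr_eq0 gt_eqF.
rewrite inver (negbTE kn); have [->|pn0] := eqVneq p 0.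
  by rewrite expR_ge0.
have pp : 0 < p by rewrite lt_neqAle eq_sym pn0.
rewrite lne_EFin// -EFinM lte_fin invrN mulrN ltrNr ltr_pdivrMr// => H.
by rewrite -[leLHS](lnK pp) ler_expR ltW.
Qed.

Lemma ln_large (y : R) :
  exists n0, forall n : nat, (n0 <= n)%N -> (0 < n)%N /\ y <= ln (n%:R : R).
Proof.
exists (Num.truncn (expR y)).+1 => n nn; have n0 : (0 < n)%N by exact: leq_trans nn.
split=> //; have nR : 0 < n%:R :> R by rewrite ltr0n.
rewrite -ler_expR lnK// ltW// (lt_le_trans (truncnS_gt _))//.
by rewrite ler_nat.
Qed.

(** For $x = \ln n / c$ take k one below the integer part of x, so that $\exp(ck) < n$ strictly.
    Then $M(n) \ge k > x - 2$, and the loss of 2 is covered by $c < c'$ once $\ln n$ is large. *)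
Lemma eventually_ge_of_sparse (M : nat -> nat) (c c' : R) :
  {homo M : m n / (m <= n)%N} -> 0 < c < c' ->
  (exists k1, forall k, (k1 <= k)%N ->
     (k <= M (Num.truncn (expR (c * k%:R))).+1)%N) ->
  exists n0, forall n, (n0 <= n)%N -> c'^-1 <= (M n)%:R / ln n%:R.
Proof.
move=> homM /andP[c0 cc'] [k1 H].
have i0 : 0 < c^-1 - c'^-1 by rewrite subr_gt0 ltf_pV2// posrE; lra.
have [n0 Hn] := ln_large (Num.max (c * (k1%:R + 2)) (2 / (c^-1 - c'^-1))).
exists n0 => n /Hn[n1]; rewrite ge_max => /andP[l1 l2].
have l0 : 0 < ln n%:R :> R.
  by apply: lt_le_trans l1; rewrite mulr_gt0// ltr_pwDr.
rewrite ler_pdivrMr// in l2; rewrite ler_pdivlMr//.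
set x := ln n%:R / c.
have xk : k1%:R + 2 <= x by rewrite ler_pdivlMr// mulrC.
have x0 : 0 <= x by rewrite divr_ge0// ltW.
have /andP[x1 x2] := truncn_itv x0.
have t2 : (k1.+2 <= Num.truncn x)%N.
  by rewrite truncn_ge_nat// -!natr1; lra.
pose k := (Num.truncn x).-1.
have kS : (k.+1 = Num.truncn x)%N by rewrite /k prednK// (leq_trans _ t2).
have kk1 : (k1 <= k)%N by rewrite -ltnS kS ltnW.
have kx : k%:R + 1 <= x by rewrite natr1 kS.
have xk2 : x < k%:R + 2 by move: x2; rewrite -kS -!natr1; lra.
have kM : (k <= M n)%N.
  apply: leq_trans (H k kk1) (homM _ _ _).
  have nR : 0 < n%:R :> R by rewrite ltr0n.
  rewrite truncn_lt_nat ?expR_ge0// -[ltRHS](lnK nR) ltr_expR.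
  rewrite mulrC -ltr_pdivlMr//; rewrite -/x; lra.
rewrite (@le_trans _ _ k%:R) ?ler_nat// mulrC.
have e1 : ln n%:R * (c^-1 - c'^-1) = x - ln n%:R / c' by rewrite mulrBr.
lra.
Qed.

(** With k one above the integer part of $\ln n / c$ one has $n \le \exp(ck)$; the strict bound M <
    k brings M(n) back to that integer part, so nothing is lost in c. *)
Lemma eventually_le_of_sparse (M : nat -> nat) (c : R) :
  {homo M : m n / (m <= n)%N} -> 0 < c ->
  (exists k1, forall k, (k1 <= k)%N ->
     (M (Num.truncn (expR (c * k%:R))) < k)%N) ->
  exists n0, forall n, (n0 <= n)%N -> (M n)%:R / ln n%:R <= c^-1.
Proof.
move=> homM c0 [k1 H].
have [n0 Hn] := ln_large (c * (k1%:R + 1)).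
exists n0 => n /Hn[n1 l1].
have l0 : 0 < ln n%:R :> R.
  by apply: lt_le_trans l1; rewrite mulr_gt0// ltr_pwDr.
rewrite ler_pdivrMr//.
set x := ln n%:R / c.
have xk : k1%:R + 1 <= x by rewrite ler_pdivlMr// mulrC.
have x0 : 0 <= x by rewrite divr_ge0// ltW.
have /andP[x1 x2] := truncn_itv x0.
have kk1 : (k1 <= (Num.truncn x).+1)%N.
  by apply: leqW; rewrite truncn_ge_nat//; lra.
have nR : 0 < n%:R :> R by rewrite ltr0n.
have nM : (n <= Num.truncn (expR (c * (Num.truncn x).+1%:R)))%N.
  rewrite truncn_ge_nat ?expR_ge0// -[leLHS](lnK nR) ler_expR.
  by rewrite mulrC -ler_pdivrMr// ltW.
have := leq_ltn_trans (homM _ _ nM) (H _ kk1).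
rewrite ltnS -(ler_nat R) => /le_trans; apply.
by rewrite mulrC.
Qed.

End limits.

(** * Almost sure bounds from countably many exponents *)

Theorem theorem4 (R : realType) (d : measure_display) (Omega : measurableType d)
  (P : probability Omega R) (theta : Omega -> Omega) (N : nat)
  (b : Omega -> nat) (A : Omega -> 'M[bool]_N.+1)
  (nu : probability (Omega * seqspace N)%type R)
  (mu : R.-pker Omega ~> seqspace N)
  (a : R) (alpha rho : nat -> R)
  (V : completeNormedModType R) (iota : {linear V -> (Omega -> R^o)})
  (Hmps : invertible_ergodic_mps P theta)
  (HA : random_transition theta b A)
  (Hnu : invariant_on_bundle P theta b A nu)
  (Hmu : sample_measures P theta b A nu mu)
  (Ha : 0 <= a < 1)
  (Halpha : alpha =O_\oo (fun g : nat => a ^+ g))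
  (Hrho : rho =O_\oo (fun g : nat => a ^+ g))
  (HV : banach_function_space iota)
  (Hent : [/\ (0 < H2_lower P mu)%E, (H2_lower P mu <= H2_upper P mu)%E
            & (H2_upper P mu < 2%:E * h_zero P mu)%E])
  (Hmix : [/\ marginal_mixing P mu alpha, fibre_mixing P theta mu alpha,
              mixing3 P theta iota rho & cylinder_regularity iota mu]
       \/ [/\ marginal_self_mixing P mu alpha, fibre_mixing P theta mu alpha,
              mixing4 P theta iota rho & cylinder_regularity iota mu]) :
  {ae P, forall w,
    {ae (mu w \x mu w)%E, forall p : seqspace N * seqspace N,
      fibre theta b A w p.1 -> fibre theta b A w p.2 ->
      (2%:E / H2_upper P mu <=
        limn_einf (fun n => ((longest_match n p.1 p.2)%:R / ln n%:R)%:E))%E}}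
  /\
  (H2_lower P mu = H2_upper P mu ->
   {ae P, forall w,
    {ae (mu w \x mu w)%E, forall p : seqspace N * seqspace N,
      fibre theta b A w p.1 -> fibre theta b A w p.2 ->
      ((longest_match n p.1 p.2)%:R / ln n%:R)%:E @[n --> \oo]
        --> (2%:E / H2_upper P mu)%E}}).
Proof.
have [Hl0 Hlu Hu0] := Hent.
have Hexp := pair_mixing_exponential Hmps Ha Halpha Hrho Hmix.
have Hinv := sample_prob_shift Hmps Hnu Hmu.
(* Condition (4) places this function in the Banach space, whose elements are measurable. *)
have Hmax k : measurable_fun setT (fun w => fine (max_cylinder mu k w)).
  have reg : cylinder_regularity iota mu by case: Hmix => [] [].
  have [xi _ /(_ k)[_ [v vE _]]] := reg.
  by rewrite vE; exact: (bfs_measurable HV v).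
have colE k : (\sum_(u : k.-tuple 'I_N.+1) marginal P mu (cylinder u) ^+ 2)%E
    = (collision P mu k)%:E.
  rewrite /collision -sumEFin; apply: eq_bigr => u _.
  by rewrite marginalE//; exact: measurable_cylinder.
have maxE k : (\int[P]_w max_cylinder mu k w)%E = (\int[P]_w max_prob mu k w)%:E.
  rewrite /Rintegral fineK.
    by apply: eq_integral => w _; rewrite /max_prob fineK// max_cylinder_fin.
  apply: integrable_fin_num => //; apply: bounded_measurable_integrable.
  exact: bounded_measurable_max_prob.
have [H HE] : exists H, H2_upper P mu = H%:E.
  exists (fine (H2_upper P mu)); rewrite fineK// fin_numE.
  rewrite gt_eqF ?(lt_le_trans _ Hlu) ?(lt_trans _ Hl0)//=.
  by rewrite lt_eqF// (lt_le_trans Hu0) ?leey.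
have H0 : 0 < H by rewrite -lte_fin -HE (lt_le_trans Hl0).
rewrite HE in Hlu Hu0 *.
have -> : (2%:E / H%:E = (2 / H)%:E)%E by rewrite inver gt_eqF.
(* A real exponent strictly in between; [h_zero] itself may be +oo. *)
have [h [Hh hh]] : exists h, H / 2 < h /\ (h%:E < h_zero P mu)%E.
  case: (h_zero P mu) Hu0 => [r| |].
  - rewrite -EFinM lte_fin => Hr; exists ((H / 2 + r) / 2).
    by split; [|rewrite lte_fin]; lra.
  - by move=> _; exists (H / 2 + 1); split; [lra|exact: ltry].
  - by rewrite gt0_muleNy ?lte_fin.
pose M (p : seqspace N * seqspace N) n := longest_match n p.1 p.2.
have homM p : {homo M p : m n / (m <= n)%N} by move=> m n; exact: longest_match_le.
have lower : {ae P, forall w, {ae pair_probability mu w, forall p,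
    forall x, x < 2 / H -> exists n0, forall n, (n0 <= n)%N ->
      x <= (M p n)%:R / ln n%:R}}.
  pose c j : R := H / 2 + j.+1%:R^-1.
  have cH j : H / 2 < c j by rewrite ltrDl invr_gt0.
  have : {ae P, forall w, forall j, {ae pair_probability mu w, forall p,
      exists k1, forall k, (k1 <= k)%N ->
      (k <= M p (Num.truncn (expR (c j * k%:R))).+1)%N}}.
    apply: ae_foralln => j; have Hj := cH j.
    apply: (@ae_longest_match_ge _ _ _ _ _ _ Hexp _ ((H / 2 + c j) / 2)).
      by apply/andP; split; lra.
    have /limn_esup_lt[k1 Hk1] : (limn_esup (log_sum_squares P mu)
        < (2 * ((H / 2 + c j) / 2))%:E)%E.
      by rewrite -/(H2_upper P mu) HE lte_fin; lra.
    exists (maxn 1 k1) => k; rewrite geq_max => /andP[k0 kk1].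
    apply: log_rate_lt => //; first exact: collision_ge0.
    by rewrite -colE; exact: Hk1.
  apply: filterS => w /ae_foralln; apply: filterS => p Hp x xH.
  (* For $x \le 0$ the bound holds because the ratio is nonnegative, also at n = 1, where division
     by 0 yields 0. *)
  have [x0|x0] := leP x 0.
    exists 1%N => n n1; rewrite (le_trans x0)// divr_ge0// ln_ge0//.
    by rewrite ler1n.
  have xH' : H / 2 < x^-1.
    by rewrite -[ltLHS]invrK ltf_pV2 ?posrE ?invr_gt0 ?divr_gt0// invf_div.
  (* Large enough for $1/(j+1) < 1/x - H/2$, that is, for [c j] to lie below 1/x. *)
  pose j := Num.truncn (x^-1 - H / 2)^-1.
  have cj : c j < x^-1.
    have : (x^-1 - H / 2)^-1 < j.+1%:R by exact: truncnS_gt.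
    rewrite -[ltRHS]invrK ltf_pV2 ?posrE ?invr_gt0 ?subr_gt0// /c.
    by rewrite ltrBrDl.
  rewrite -[x]invrK; apply: eventually_ge_of_sparse (Hp j) => //.
  by rewrite cj andbT (lt_trans _ (cH j))// divr_gt0.
split=> [|Hlue].
  apply: filterS lower => w; apply: filterS => p Hp _ _.
  exact: limn_einf_ge_of_lt.
have upper : {ae P, forall w, {ae pair_probability mu w, forall p,
    forall x, 2 / H < x -> exists n0, forall n, (n0 <= n)%N ->
      (M p n)%:R / ln n%:R <= x}}.
  (* Increases to H/2; the denominator j + 2 keeps even [c 0] positive. *)
  pose c j : R := H / 2 - H / 2 / j.+2%:R.
  have cH j : c j < H / 2 by rewrite gtrBl !divr_gt0.
  have c0 j : 0 < c j.
    by rewrite subr_gt0 ltr_pdivrMr// ltr_pMr ?divr_gt0// ltr1n.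
  have : {ae P, forall w, forall j, {ae pair_probability mu w, forall p,
      exists k1, forall k, (k1 <= k)%N ->
      (M p (Num.truncn (expR (c j * k%:R))) < k)%N}}.
    apply: ae_foralln => j; have Hj := cH j.
    apply: (@ae_longest_match_lt _ _ _ _ _ _ _ Hmps Hinv Hexp Hmax _
      ((H / 2 + c j) / 2) h) => //; try lra.
      have /limn_einf_gt[k1 Hk1] : ((2 * ((H / 2 + c j) / 2))%:E
          < limn_einf (log_sum_squares P mu))%E.
        (* An upper bound on the collision probability comes from the lower entropy, which is H by
           the assumption that the Rényi entropy exists. *)
        by rewrite -/(H2_lower P mu) Hlue lte_fin; lra.
      exists (maxn 1 k1) => k; rewrite geq_max => /andP[k0 kk1].
      apply: log_rate_gt => //; first exact: collision_ge0.
      by rewrite -colE; exact: Hk1.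
    have /limn_einf_gt[k1 Hk1] := hh.
    exists (maxn 1 k1) => k; rewrite geq_max => /andP[k0 kk1].
    apply: log_rate_gt => //.
      by apply: Rintegral_ge0 => w _; exact: max_prob_ge0.
    by rewrite -maxE; exact: Hk1.
  apply: filterS => w /ae_foralln; apply: filterS => p Hp x xH.
  have x0 : 0 < x by rewrite (lt_trans _ xH)// divr_gt0.
  have xH' : x^-1 < H / 2.
    by rewrite -[ltRHS]invrK ltf_pV2 ?posrE ?invr_gt0 ?divr_gt0// invf_div.
  have y0 : 0 < H / 2 - x^-1 by rewrite subr_gt0.
  pose j := Num.truncn (H / 2 / (H / 2 - x^-1)).
  have cj : x^-1 <= c j.
    have : H / 2 / (H / 2 - x^-1) <= j.+2%:R.
      by rewrite ltW// (lt_le_trans (truncnS_gt _))// ler_nat.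
    rewrite ler_pdivrMr// [_ * (_ - _)]mulrC -ler_pdivrMr// => hj; by rewrite /c lerBrDl -lerBrDr.
  have [n0 Hn] := eventually_le_of_sparse (homM p) (c0 j) (Hp j).
  exists n0 => n nn; rewrite (le_trans (Hn n nn))//.
  by rewrite -[leRHS]invrK lef_pV2 ?posrE ?invr_gt0 ?c0.
apply: filterS2 lower upper => w; apply: filterS2 => p Hl Hu _ _.
exact: cvg_of_eventually.
Qed.
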